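(* Let $s\in(0,1)$ and let $\Omega\subset\mathbb{R}^N$ be an open and bounded set. For every $u\in \mathcal{W}^{s,1}_0(\Omega)\setminus\{0\}$ we have $$\frac{[u]_{W^{s,1}(\mathbb{R}^N)}}{\|u\|_{L^1(\Omega)}}\ge h_s(\Omega).$$ Moreover, if equality holds for $u$, then almost every level set of $u$ with positive $N$-dimensional Lebesgue measure is an $s$-Cheeger set of $\Omega$; that is, for almost every $t>0$ such that $\Omega_t=\{x\in\Omega : |u(x)|>t\}$ has positive measure, $\Omega_t$ is an $s$-Cheeger set of $\Omega$. Finally, if $\Omega$ has Lipschitz boundary, then $$\lambda^s_{1,1}(\Omega)=h_s(\Omega).$$
   Context: For a measurable function $u$ on $\mathbb{R}^N$, $[u]_{W^{s,1}(\mathbb{R}^N)}=\int_{\mathbb{R}^N}\int_{\mathbb{R}^N}\frac{|u(x)-u(y)|}{|x-y|^{N+s}}\,dx\,dy$. The $s$-perimeter of a Borel set $E$ is $P_s(E)=[1_E]_{W^{s,1}(\mathbb{R}^N)}$ (possibly $+\infty$), where $1_E$ is the characteristic function. The $s$-Cheeger constant is $h_s(\Omega)=\inf_{E\subset\Omega}\frac{P_s(E)}{|E|}$ (infimum over subsets of $\Omega$ of positive Lebesgue measure), and an $s$-Cheeger set of $\Omega$ is a set $E\subset\Omega$ attaining this infimum. $\widetilde W^{s,1}_0(\Omega)$ is the closure of $C^\infty_0(\Omega)$ with respect to the norm $u\mapsto [u]_{W^{s,1}(\mathbb{R}^N)}+\|u\|_{L^1(\Omega)}$ (functions extended by $0$),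 while $$\mathcal{W}^{s,1}_0(\Omega)=\left\{u\in L^1(\Omega) : [u]_{W^{s,1}(\mathbb{R}^N)}<+\infty \mbox{ and } u=0 \mbox{ a.e. in } \mathbb{R}^N\setminus\Omega\right\}.$$ Finally $\lambda^s_{1,1}(\Omega)=\inf_{u\in \widetilde W^{s,1}_0(\Omega)} \left\{[u]_{W^{s,1}(\mathbb{R}^N)} : \|u\|_{L^1(\Omega)}=1,\ u\ge 0\right\}$. *)

(* Defs.v *)
From HB Require Import structures.
From mathcomp Require Import all_boot all_order all_algebra.
From mathcomp Require Import all_classical all_reals all_analysis.
From mathcomp Require Import measurable_realfun lebesgue_integral_fubini.
Import Order.TTheory GRing.Theory Num.Theory.
Import numFieldNormedType.Exports.

Set Implicit Arguments.
Unset Strict Implicit.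
Unset Printing Implicit Defensive.

Local Open Scope classical_set_scope.
Local Open Scope ring_scope.

Section borel_rV.
Context {R : realType} {n : nat}.

Definition borel_rV : set (set 'rV[R]_n) := <<s @open 'rV[R]_n >>.

Let borel_rV0 : borel_rV set0.
Proof. exact: sigma_algebra0. Qed.

Let borel_rVC A : borel_rV A -> borel_rV (~` A).
Proof. exact: sigma_algebraC. Qed.

Let borel_rV_bigcup (F : (set 'rV[R]_n)^nat) :
  (forall i, borel_rV (F i)) -> borel_rV (\bigcup_i F i).
Proof. exact: sigma_algebra_bigcup. Qed.

HB.instance Definition _ := @isMeasurable.Build default_measure_display
  'rV[R]_n borel_rV borel_rV0 borel_rVC borel_rV_bigcup.

End borel_rV.

Section borel_rV_theory.
Context {R : realType} {n : nat}.
Implicit Types (U : set 'rV[R]_n).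

Let rat_ball (p : 'rV[rat]_n * nat) : set 'rV[R]_n :=
  ball (map_mx ratr p.1 : 'rV[R]_n) p.2.+1%:R^-1.

Lemma open_rV_bigcup U : open U ->
  U = \bigcup_(p in [set p | rat_ball p `<=` U]) rat_ball p.
Proof.
move=> oU; apply/seteqP; split => [x Ux|x [p pU]]; last exact: pU.
have /nbhs_ballP[e /= e0 xeU] : nbhs x U by exact: open_nbhs_nbhs.
have [k /= ke] : exists k : nat, k.+1%:R^-1 < e / 2 :> R.
  have e20 : 0 < e / 2 by rewrite divr_gt0.
  by near \oo => k; exists k; near: k; exact: near_infty_natSinv_lt (PosNum e20).
have k0 : 0 < k.+1%:R^-1 :> R by rewrite invr_gt0.
have q_ i : {q : rat | `|ratr q - x ord0 i| < k.+1%:R^-1}.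
  apply: cid; have : x ord0 i - k.+1%:R^-1 < x ord0 i + k.+1%:R^-1.
    by rewrite ltrBlDr -addrA ltrDl addr_gt0.
  move=> /rat_in_itvoo[q]; rewrite in_itv/= => /andP[q1 q2].
  by exists q; rewrite ltr_distl q1 q2.
pose c : 'rV[rat]_n := \row_i sval (q_ i).
have cx : rat_ball (c, k) x.
  split => // i j; rewrite ord1 !mxE; exact: (svalP (q_ j)).
exists (c, k) => // y cy; apply: xeU; apply: (@le_ball _ _ _ (k.+1%:R^-1 + k.+1%:R^-1)).
  by rewrite [leRHS](splitr e) lerD// ltW.
exact: ball_triangle (ball_sym cx) cy.
Unshelve. all: by end_near. Qed.

Lemma measurable_coord_rV (i : 'I_n) :
  measurable_fun [set: 'rV[R]_n] (fun v : 'rV[R]_n => v ord0 i).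
Proof.
apply: (measurability _ (RGenOpens.measurableE R)) => _ [_ [a [b ->]] <-].
rewrite setTI; apply: sub_sigma_algebra.
by apply: open_comp => [v _|]; [exact: coord_continuous|exact: interval_open].
Qed.

Lemma measurable_fun_rV d (T : measurableType d) (f : T -> 'rV[R]_n) :
  (forall i, measurable_fun [set: T] (fun t => f t ord0 i)) ->
  measurable_fun [set: T] f.
Proof.
move=> mf; apply: (measurability _ (erefl : @measurable _ 'rV[R]_n = borel_rV)).
move=> _ [U oU <-]; rewrite setTI (open_rV_bigcup oU) preimage_bigcup.
rewrite bigcup_mkcond; apply: countable_bigcupT_measurable => // p.
case: ifPn => // _.
rewrite (_ : _ @^-1` _ = \bigcap_(i in [set: 'I_n])
    ((fun t => f t ord0 i) @^-1` ball (ratr (p.1 ord0 i) : R) p.2.+1%:R^-1)).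
  apply: fin_bigcap_measurable => // i _.
  rewrite -[X in measurable X]setTI; apply: mf => //.
  by apply: open_measurable; exact: ball_open.
apply/seteqP; split => [t [_ ft] i _|t ft].
  by have := ft ord0 i; rewrite mxE.
by split=> // i j; rewrite ord1 mxE; exact: ft.
Qed.

End borel_rV_theory.

Section lebesgue_rV_step.
Context {R : realType} {n : nat}.
Local Open Scope ereal_scope.

Definition cons_rV (z : measurableTypeR R * 'rV[R]_n) : 'rV[R]_n.+1 :=
  \row_i oapp (fun j => z.2 ord0 j) z.1 (unlift ord0 i).

Lemma cons_rV0 z : cons_rV z ord0 ord0 = z.1.
Proof. by rewrite mxE unlift_none. Qed.

Lemma cons_rVS z (i : 'I_n) : cons_rV z ord0 (lift ord0 i) = z.2 ord0 i.
Proof. by rewrite mxE liftK. Qed.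

Lemma measurable_cons_rV : measurable_fun [set: _] cons_rV.
Proof.
apply: measurable_fun_rV => i; case: (unliftP ord0 i) => [j|] ->.
  have -> : (fun z => cons_rV z ord0 (lift ord0 j)) =
      (fun v : 'rV[R]_n => v ord0 j) \o snd by apply/funext => z; rewrite cons_rVS.
  exact: measurableT_comp (measurable_coord_rV j) measurable_snd.
have -> : (fun z => cons_rV z ord0 ord0) = fst.
  by apply/funext => z; rewrite cons_rV0.
exact: measurable_fst.
Qed.

Variable mu : {sigma_finite_measure set 'rV[R]_n -> \bar R}.

Definition lebesgue_cons : set 'rV[R]_n.+1 -> \bar R :=
  pushforward (lebesgue_measure \x mu) cons_rV.

Let lebesgue_cons0 : lebesgue_cons set0 = 0.
Proof. by rewrite /lebesgue_cons /pushforward preimage_set0 measure0. Qed.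

Let lebesgue_cons_ge0 A : 0 <= lebesgue_cons A.
Proof. by rewrite /lebesgue_cons /pushforward; exact: measure_ge0. Qed.

Let measurable_cons_preimage (A : set 'rV[R]_n.+1) :
  measurable A -> measurable (cons_rV @^-1` A).
Proof. by rewrite -[X in _ -> measurable X]setTI; exact: measurable_cons_rV. Qed.

Let lebesgue_cons_sigma_additive : semi_sigma_additive lebesgue_cons.
Proof.
move=> F mF tF mUF; rewrite /lebesgue_cons /pushforward preimage_bigcup.
apply: measure_semi_sigma_additive.
- by move=> k; exact: measurable_cons_preimage.
- apply/trivIsetP => /= i j _ _ ij; rewrite -preimage_setI.
  by move/trivIsetP : tF => /(_ _ _ _ _ ij) ->//; rewrite preimage_set0.
- by rewrite -preimage_bigcup; exact: measurable_cons_preimage.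
Qed.

HB.instance Definition _ := isMeasure.Build _ _ _ lebesgue_cons
  lebesgue_cons0 lebesgue_cons_ge0 lebesgue_cons_sigma_additive.

Lemma lebesgue_cons_box (A : set (measurableTypeR R)) (B : set 'rV[R]_n) :
  measurable A -> measurable B ->
  lebesgue_cons [set v : 'rV[R]_n.+1 | A (v ord0 ord0) /\ B (\row_j v ord0 (lift ord0 j))] =
  lebesgue_measure A * mu B.
Proof.
move=> mA mB; rewrite -product_measure1E//; rewrite /lebesgue_cons /pushforward; congr (product_measure1 _ _ _).
have rowE z : \row_j cons_rV z ord0 (lift ord0 j) = z.2.
  by apply/rowP => j; rewrite mxE cons_rVS.
by apply/seteqP; split => z /=; rewrite cons_rV0 rowE.
Qed.

Let lebesgue_cons_sigma_finite : sigma_finite setT lebesgue_cons.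
Proof.
have mtail : measurable_fun [set: 'rV[R]_n.+1]
    (fun v => \row_j v ord0 (lift ord0 j) : 'rV[R]_n).
  apply: measurable_fun_rV => i.
  under eq_fun do rewrite mxE.
  exact: measurable_coord_rV.
have /sigma_finiteP[F [TF ndF Foo]] := sigma_finiteT (@lebesgue_measure R).
have /sigma_finiteP[G [TG ndG Goo]] := sigma_finiteT mu.
exists (fun k => [set v : 'rV[R]_n.+1 | F k (v ord0 ord0) /\
                          G k (\row_j v ord0 (lift ord0 j))]).
  apply/esym/seteqP; split => // v _.
  have [i _ Fi] : (\bigcup_i F i) (v ord0 ord0) by rewrite -TF.
  have [k _ Gk] : (\bigcup_i G i) (\row_j v ord0 (lift ord0 j)) by rewrite -TG.
  exists (maxn i k) => //; split.
  - by move: Fi; exact/subsetPset/ndF/leq_maxl.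
  - by move: Gk; exact/subsetPset/ndG/leq_maxr.
move=> k; have [mF Fk] := Foo k; have [mG Gk] := Goo k; split.
  apply: measurableI; rewrite -[X in measurable X]setTI.
    exact: (measurable_coord_rV ord0).
  exact: mtail.
by rewrite lebesgue_cons_box// lte_mul_pinfty// ge0_fin_numE.
Qed.

HB.instance Definition _ := Measure_isSigmaFinite.Build _ _ _ lebesgue_cons
  lebesgue_cons_sigma_finite.

End lebesgue_rV_step.

Section lebesgue_rV.
Context {R : realType}.
Local Open Scope ereal_scope.

Fixpoint lebesgue_rV_rec (n : nat) :
    {sigma_finite_measure set 'rV[R]_n -> \bar R} :=
  match n with
  | 0%N => \d_(0%R : 'rV[R]_0)
  | n.+1 => lebesgue_cons (lebesgue_rV_rec n)
  end.

Definition lebesgue_rV {n : nat} : set 'rV[R]_n -> \bar R := lebesgue_rV_rec n.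

HB.instance Definition _ n := SigmaFiniteMeasure.on (@lebesgue_rV n).

Lemma lebesgue_rV_box n (A : 'I_n -> set (measurableTypeR R)) :
  (forall i, measurable (A i)) ->
  lebesgue_rV [set v : 'rV[R]_n | forall i, A i (v ord0 i)] =
  \prod_(i < n) lebesgue_measure (A i).
Proof.
elim: n A => [|n IHn] A mA.
  rewrite big_ord0 (_ : [set _ | _] = setT); first by rewrite /lebesgue_rV /= diracT.
  by apply/seteqP; split => // v _ [].
rewrite big_ord_recl -IHn// -lebesgue_cons_box//; last first.
  rewrite (_ : [set _ | _] = \bigcap_(i in [set: 'I_n])
    ((fun v : 'rV[R]_n => v ord0 i) @^-1` A (lift ord0 i))).
    apply: fin_bigcap_measurable => [|i _]; first exact: finite_finset.
    rewrite -[X in measurable X]setTI.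
    exact: (measurable_coord_rV i measurableT (mA _)).
  by apply/seteqP; split => v vA i; [move=> _|]; exact: vA.
congr (lebesgue_cons _ _); apply/seteqP; split => v /=.
  by move=> vA; split => // i; rewrite mxE; exact: vA.
move=> [v0 vA] i; case: (unliftP ord0 i) => [j|] -> //.
by have := vA j; rewrite mxE.
Qed.

End lebesgue_rV.

Section euclidean_space.
Context {R : realType} {N : nat}.
Implicit Types (x : 'rV[R]_N) (U : set 'rV[R]_N).

(* The library norm on row vectors is the sup norm; it induces the same
   topology as the Euclidean norm. *)
Definition enorm x : R := Num.sqrt (\sum_(i < N) x ord0 i ^+ 2).

(* Near each boundary point, in suitable orthonormal coordinates y = x Q,
   the set is the strict epigraph y_i > g (y') of a Lipschitz function g of the
   remaining coordinates y' (the row vector y with y_i removed). *)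
Definition lipschitz_boundary U :=
  forall x0, closure U x0 -> ~ interior U x0 ->
  exists (r : R) (Q : 'M[R]_N) (i : 'I_N) (g : 'rV[R]_N.-1 -> R),
    [/\ 0 < r, Q *m Q^T = 1%:M, lipschitz (g : _ -> R^o) &
        forall x, enorm (x - x0) < r ->
          U x <-> g (col' i (x *m Q)) < (x *m Q) ord0 i].

Fixpoint class_C (k : nat) (f : 'rV[R]_N -> R) : Prop :=
  match k with
  | 0%N => continuous f
  | k.+1 => forall i : 'I_N,
      (forall x, derivable (f : _ -> R^o) x (delta_mx ord0 i)) /\
      class_C k (fun x => 'D_(delta_mx ord0 i) (f : _ -> R^o) x)
  end.

Definition smooth (f : 'rV[R]_N -> R) := forall k, class_C k f.

Definition test_function U (f : 'rV[R]_N -> R) :=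
  [/\ smooth f, compact (closure [set x | f x != 0]) &
      closure [set x | f x != 0] `<=` U].

End euclidean_space.

Section fractional_cheeger.
Context {R : realType} {N : nat}.
Local Open Scope ereal_scope.
Implicit Types (s : R) (u : 'rV[R]_N -> R) (Omega E : set 'rV[R]_N).

Definition Ws1_seminorm s u : \bar R :=
  \int[lebesgue_rV]_x \int[lebesgue_rV]_y
    (`|u x - u y| / enorm (x - y) `^ (N%:R + s))%:E.

Definition L1norm Omega u : \bar R := \int[lebesgue_rV]_(x in Omega) `|u x|%:E.

Definition s_perimeter s E : \bar R := Ws1_seminorm s \1_E.

Definition cheeger_ratio s E : \bar R := s_perimeter s E / lebesgue_rV E.

Definition cheeger_admissible Omega : set (set 'rV[R]_N) :=
  [set E | [/\ measurable E, E `<=` Omega & 0 < lebesgue_rV E]].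

Definition cheeger_constant s Omega : \bar R :=
  ereal_inf (cheeger_ratio s @` cheeger_admissible Omega).

Definition cheeger_set s Omega E : Prop :=
  cheeger_admissible Omega E /\ cheeger_ratio s E = cheeger_constant s Omega.

(* Functions of L^1(Omega) extended by 0; as everywhere below, elements of
   function spaces are represented by Borel functions on the whole space and
   pointwise conditions hold almost everywhere. *)
Definition L1_ext Omega : set ('rV[R]_N -> R) :=
  [set u | [/\ measurable_fun [set: 'rV[R]_N] u,
               lebesgue_rV.-integrable Omega (EFin \o u) &
               {ae lebesgue_rV, forall x, ~ Omega x -> u x = 0%R}]].

Definition calW s Omega : set ('rV[R]_N -> R) :=
  [set u | L1_ext Omega u /\ Ws1_seminorm s u < +oo].

Definition tildeW s Omega : set ('rV[R]_N -> R) :=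
  [set u | L1_ext Omega u /\
    forall e : R, (0 < e)%R -> exists2 phi, test_function Omega phi &
      Ws1_seminorm s (u \- phi)%R + L1norm Omega (u \- phi)%R < e%:E].

Definition lambda11 s Omega : \bar R :=
  ereal_inf (Ws1_seminorm s @` [set u | [/\ tildeW s Omega u,
    L1norm Omega u = 1 & {ae lebesgue_rV, forall x, (0 <= u x)%R}]]).

Definition superlevel Omega u (t : R) : set 'rV[R]_N :=
  [set x | Omega x /\ (t < `|u x|)%R].

End fractional_cheeger.

(* Main.v *)
Require Import Defs.
From mathcomp Require Import finmap all_boot all_order all_algebra.
From mathcomp Require Import all_classical all_reals all_analysis.
From mathcomp Require Import measurable_realfun.
From mathcomp Require Import lra ring.
Import Order.TTheory GRing.Theory Num.Theory.
Import numFieldNormedType.Exports.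

Set Implicit Arguments.
Unset Strict Implicit.
Unset Printing Implicit Defensive.

Local Open Scope classical_set_scope.
Local Open Scope ring_scope.
Local Open Scope ereal_scope.

(** Let [h] be the Cheeger constant of [Omega] and [W] the Gagliardo seminorm.

    Lower bound. Put [v = |u|] on [Omega] and [v = 0] elsewhere, with superlevel
    sets [E_t]. Since [|a - b|] is the integral over [t > 0] of
    [|1_(t < a) - 1_(t < b)|], Tonelli's theorem shows that [W v] is the integral
    of [P_s(E_t)] and the mass of [v] that of [|E_t|]
    ([integral_perimeter_level], [L1norm_level]). Each [E_t] is contained in
    [Omega], so [P_s(E_t) >= h |E_t|], and integration gives
    [W u >= W v >= h ||u||_1]. In case of equality the nonnegative function
    [P_s(E_t) - h |E_t|] has zero integral, hence vanishes for almost every [t]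
    ([cheeger_set_superlevel]).

    The eigenvalue. That [lambda11 >= h] is the lower bound again. For the
    converse, every [E] contained in [Omega] must be matched by a nonnegative
    test function whose Rayleigh quotient exceeds the Cheeger ratio of [E] by
    arbitrarily little. Only one-sided bounds on quotients are needed, never the
    density of test functions in the seminorm.

    - If the closure of [E] lies in [Omega], mollify [1_E] at a small scale. A
      mollification is an average of translates, so [W], being convex and
      translation invariant, grows by no more than the mass does
      ([exists_mollification]).

    - If [f] preserves distances up to a factor [L] close to 1, passing from [E]
      to the preimage of [E] under [f] changes the Cheeger ratio by a factor
      close to 1 ([perimeter_near_isometry], [volume_near_isometry]). No change
      of variables formula is involved: when [|x - y| <= L |f x - f y|] in the
      sup norm, the preimage of a cube lies in a box whose sides are at most [L]
      times longer, so that [f] pulls back Lebesgue measure to at most [L ^ N]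
      times itself ([lebesgue_preimage_expanding]).

    - If the boundary is Lipschitz there are such maps [f], with [L] arbitrarily
      close to 1, that send the complement of [Omega] into its interior
      ([inward_deformation]); the preimage of [E] is then compactly contained in
      [Omega]. Near a boundary point the map adds a small multiple of a fixed
      direction pointing below the graph, cut off by a cone. A point outside
      [Omega] either does not move or lands in the exterior, and this survives
      composition, so finitely many such maps compose to the required one. *)

(** * The Gagliardo seminorm and superpositions of functions *)

Section iterated_integrals.
Context d1 d2 (T1 : measurableType d1) (T2 : measurableType d2) (R : realType).
Variables (m1 : {measure set T1 -> \bar R})
  (m2 : {sigma_finite_measure set T2 -> \bar R}).

Lemma ge0_le_iterated_integral (G H : T1 * T2 -> \bar R) :
  measurable_fun [set: T1 * T2] G -> (forall p, 0 <= G p) ->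
  measurable_fun [set: T1 * T2] H -> (forall p, 0 <= H p) ->
  {ae m1, forall x, {ae m2, forall y, G (x, y) <= H (x, y)}} ->
  \int[m1]_x \int[m2]_y G (x, y) <= \int[m1]_x \int[m2]_y H (x, y).
Proof.
move=> mG G0 mH H0 GH; apply: ae_ge0_le_integral => //.
- by move=> x _; apply: integral_ge0 => y _; exact: G0.
- exact: (measurable_fun_fubini_tonelli_F _ mG G0).
- by move=> x _; apply: integral_ge0 => y _; exact: H0.
- exact: (measurable_fun_fubini_tonelli_F _ mH H0).
apply: filterS GH => x GHx _; apply: ae_ge0_le_integral => //.
- exact: (measurable_fun_pair2 x mG).
- exact: (measurable_fun_pair2 x mH).
by apply: filterS GHx => y GHxy _.
Qed.

End iterated_integrals.

Section gagliardo.
Context {R : realType} {N : nat}.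
Implicit Types (s : R) (u v : 'rV[R]_N -> R).

Definition gagliardo_kernel s (x y : 'rV[R]_N) : R :=
  ((enorm (x - y) `^ (N%:R + s))^-1)%R.

Lemma gagliardo_kernel_ge0 s x y : (0 <= gagliardo_kernel s x y)%R.
Proof. by rewrite invr_ge0 powR_ge0. Qed.

Lemma measurable_fun_subr_rV d (T : measurableType d) (f g : T -> 'rV[R]_N) :
  measurable_fun [set: T] f -> measurable_fun [set: T] g ->
  measurable_fun [set: T] (fun t => f t - g t)%R.
Proof.
move=> mf mg; apply: measurable_fun_rV => i.
under eq_fun do rewrite !mxE.
by apply: measurable_funB; exact: (measurableT_comp (measurable_coord_rV i)).
Qed.

Lemma measurable_fun_addr_rV d (T : measurableType d) (f g : T -> 'rV[R]_N) :
  measurable_fun [set: T] f -> measurable_fun [set: T] g ->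
  measurable_fun [set: T] (fun t => f t + g t)%R.
Proof.
move=> mf mg; apply: measurable_fun_rV => i.
under eq_fun do rewrite !mxE.
by apply: measurable_funD; exact: (measurableT_comp (measurable_coord_rV i)).
Qed.

Lemma measurable_enorm : measurable_fun [set: 'rV[R]_N] (@enorm R N).
Proof.
apply: measurableT_comp; first exact: (continuous_measurable_fun (@sqrt_continuous R)).
by apply: measurable_sum => i; apply: measurable_funX; exact: measurable_coord_rV.
Qed.

Lemma measurable_gagliardo_kernel s d (T : measurableType d)
    (f g : T -> 'rV[R]_N) :
  measurable_fun [set: T] f -> measurable_fun [set: T] g ->
  measurable_fun [set: T] (fun t => gagliardo_kernel s (f t) (g t)).
Proof.
move=> mf mg; rewrite /gagliardo_kernel; under eq_fun do rewrite -powRN.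
apply: (measurableT_comp (measurable_powR _)).
by apply: (measurableT_comp measurable_enorm); exact: measurable_fun_subr_rV.
Qed.

Definition Ws1_integrand s u (p : 'rV[R]_N * 'rV[R]_N) : \bar R :=
  (`|u p.1 - u p.2| * gagliardo_kernel s p.1 p.2)%:E.

Lemma Ws1_seminormE s u : Ws1_seminorm s u =
  \int[lebesgue_rV]_x \int[lebesgue_rV]_y Ws1_integrand s u (x, y).
Proof. by []. Qed.

Lemma Ws1_integrand_ge0 s u p : 0 <= Ws1_integrand s u p.
Proof. by rewrite lee_fin mulr_ge0// gagliardo_kernel_ge0. Qed.

Lemma measurable_Ws1_integrand s u : measurable_fun [set: 'rV[R]_N] u ->
  measurable_fun [set: 'rV[R]_N * 'rV[R]_N] (Ws1_integrand s u).
Proof.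
move=> mu; apply/measurable_EFinP/measurable_funM; last first.
  exact: measurable_gagliardo_kernel.
apply: measurableT_comp => //; apply: measurable_funB.
  exact: (measurableT_comp mu measurable_fst).
exact: (measurableT_comp mu measurable_snd).
Qed.

Section superposition.
Context d (T : measurableType d) (mu : {sigma_finite_measure set T -> \bar R}).
Variable F : T -> 'rV[R]_N -> R.
Hypothesis mF : measurable_fun [set: T * 'rV[R]_N] (fun p => F p.1 p.2).

Let G s (p : T * 'rV[R]_N * 'rV[R]_N) : \bar R :=
  (`|F p.1.1 p.1.2 - F p.1.1 p.2| * gagliardo_kernel s p.1.2 p.2)%:E.

Let mG s : measurable_fun [set: _] (G s).
Proof.
apply/measurable_EFinP; apply: measurable_funM; last first.
  apply: measurable_gagliardo_kernel; last exact: measurable_snd.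
  exact: (measurableT_comp measurable_snd measurable_fst).
apply: measurableT_comp => //; apply: measurable_funB.
  exact: (measurableT_comp mF measurable_fst).
apply: (measurableT_comp mF (g := fun p : T * 'rV[R]_N * 'rV[R]_N => (p.1.1, p.2))).
apply: measurable_fun_pair; last exact: measurable_snd.
exact: (measurableT_comp measurable_fst measurable_fst).
Qed.

Let G0 s p : 0 <= G s p.
Proof. by rewrite lee_fin mulr_ge0// gagliardo_kernel_ge0. Qed.

Let mG1 s : measurable_fun [set: T * 'rV[R]_N]
  (fun p => \int[lebesgue_rV]_y G s (p, y)).
Proof. exact: (measurable_fun_fubini_tonelli_F _ (mG s) (G0 s)). Qed.

Let G10 s p : 0 <= \int[@lebesgue_rV R N]_y G s (p, y).
Proof. exact: integral_ge0. Qed.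

Lemma measurable_Ws1_seminorm_family s :
  measurable_fun [set: T] (fun t => Ws1_seminorm s (F t)).
Proof. exact: (measurable_fun_fubini_tonelli_F _ (mG1 s) (G10 s)). Qed.

(** Tonelli. For the indicators of superlevel sets this is the coarea formula;
    for the translates of a function it yields Minkowski's integral
    inequality. *)
Lemma integral_Ws1_seminorm s : \int[mu]_t Ws1_seminorm s (F t) =
  \int[lebesgue_rV]_x \int[lebesgue_rV]_y
    ((\int[mu]_t `|F t x - F t y|%:E) * (gagliardo_kernel s x y)%:E).
Proof.
rewrite (fubini_tonelli _ (mG1 s) (G10 s)); apply: eq_integral => x _.
pose H (p : T * 'rV[R]_N) := G s (p.1, x, p.2).
have mH : measurable_fun [set: _] H.
  apply: (measurableT_comp (mG s) (g := fun p => (p.1, x, p.2))).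
  apply: measurable_fun_pair; last exact: measurable_snd.
  by apply: measurable_fun_pair => //; exact: measurable_fst.
have H0 p : 0 <= H p by exact: G0.
transitivity (\int[mu]_t \int[lebesgue_rV]_y H (t, y)); first by [].
rewrite (fubini_tonelli _ mH H0); apply: eq_integral => y _.
rewrite /H /G /=; under eq_integral do rewrite EFinM.
rewrite ge0_integralZr// ?lee_fin ?gagliardo_kernel_ge0//.
apply/measurable_EFinP/measurableT_comp => //; apply: measurable_funB;
  apply: (measurableT_comp mF (g := fun t => (t, _)));
  exact: measurable_fun_pair.
Qed.

End superposition.

End gagliardo.

(** * Volume of preimages under expanding maps *)

Section sup_norm_rV.
Context {R : realType} {N : nat}.
Implicit Types v : 'rV[R]_N.

Lemma rV_norm_leP v (r : R) : (0 <= r)%R ->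
  (forall i, `|v ord0 i| <= r)%R <-> (`|v| <= r)%R.
Proof.
move=> r0; have -> : `|v|%R = \big[Num.max/0%R]_ij `|v ij.1 ij.2|%R by exact: mx_normrE.
split => [vr|/bigmax_leP[_ vr] i].
  by apply/bigmax_leP; split => // -[i j] _ /=; rewrite (ord1 i).
exact: (vr (ord0, i)).
Qed.

Lemma coord_le_norm v i : (`|v ord0 i| <= `|v|)%R.
Proof. by move: i; apply/rV_norm_leP. Qed.

Lemma measurable_open_rV (U : set 'rV[R]_N) : open U -> measurable U.
Proof. exact: sub_sigma_algebra. Qed.

Lemma measurable_closed_rV (U : set 'rV[R]_N) : closed U -> measurable U.
Proof.
move=> cU; rewrite -[U]setCK; apply: measurableC; apply: measurable_open_rV.
exact: closed_openC.
Qed.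

Lemma bigcup_ball_rV : \bigcup_n ball (0%R : 'rV[R]_N) n%:R = setT.
Proof.
apply/seteqP; split => // v _; exists (Num.truncn `|v|).+1 => //.
by rewrite mx_norm_ball /ball_ /= sub0r normrN truncnS_gt.
Qed.

End sup_norm_rV.

Section boxes.
Context {R : realType} {N : nat}.

Lemma measurable_box_rV (A : 'I_N -> set (measurableTypeR R)) :
  (forall i, measurable (A i)) ->
  measurable [set v : 'rV[R]_N | forall i, A i (v ord0 i)].
Proof.
move=> mA; rewrite (_ : [set _ | _] = \bigcap_(i in [set: 'I_N])
    ((fun v : 'rV[R]_N => v ord0 i) @^-1` A i)).
  apply: fin_bigcap_measurable => [|i _]; first exact: finite_finset.
  rewrite -[X in measurable X]setTI.
  exact: (measurable_coord_rV i measurableT (mA i)).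
by apply/seteqP; split => v vA i; [move=> _|]; exact: vA.
Qed.

End boxes.

Section regularity.
Context {R : realType} {N : nat}.
Variable mu : {measure set 'rV[R]_N -> \bar R}.
Hypothesis muT : mu setT < +oo.

Let squeezed (A : set 'rV[R]_N) := forall e : R, (0 < e)%R ->
  exists F U, [/\ closed F, open U, F `<=` A, A `<=` U & mu (U `\` F) < e%:E].

Let mu_fin A : measurable A -> mu A < +oo.
Proof. by move=> mA; apply: le_lt_trans muT; rewrite le_measure// inE. Qed.

Let eventually_small (D : (set 'rV[R]_N)^nat) (e : R) :
  (forall n, measurable (D n)) -> nonincreasing_seq D ->
  mu (\bigcap_n D n) < e%:E -> exists n, mu (D n) < e%:E.
Proof.
move=> mD nD De.
have mC : measurable (\bigcap_n D n) by exact: bigcapT_measurable.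
have := nonincreasing_cvg_mu (mu_fin (mD 0%N)) mD mC nD.
move=> /(_ _ (open_ereal_lt' De))[n _ /(_ n (leqnn n)) Dne]; by exists n.
Qed.

Let squeezed_open U : open U -> squeezed U.
Proof.
move=> oU e e0.
(* points at distance at least [(n + 1)^-1] from the complement of [U] *)
pose F n : set 'rV[R]_N := ~` \bigcup_(y in ~` U) ball y n.+1%:R^-1%R.
have cF n : closed (F n).
  by apply: open_closedC; apply: bigcup_open => y _; exact: ball_open.
have FU n : F n `<=` U.
  move=> x Fx; apply: contrapT => Ux; apply: Fx; exists x => //.
  by apply: ballxx; rewrite invr_gt0.
have [n Dn] : exists n, mu (U `\` F n) < e%:E.
  apply: eventually_small.
  - by move=> n; apply: measurableD; [exact: measurable_open_rV|exact: measurable_closed_rV].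
  - move=> m n mn; apply/subsetPset; apply: setDS; apply: subsetC.
    move=> x [y Uy yx]; exists y => //; apply: le_ball yx.
    by rewrite lef_pV2 ?posrE// ler_nat ltnS.
  - rewrite (_ : \bigcap_n _ = set0) ?measure0//; apply/seteqP; split => // x Ux.
    have /nbhs_ballP[r /= r0 xrU] : nbhs x U.
      by apply: open_nbhs_nbhs; split => //; have [] := Ux 0%N I.
    have [n nr] : exists n : nat, (n.+1%:R^-1 < r)%R.
      near \oo => n; exists n; near: n; exact: near_infty_natSinv_lt (PosNum r0).
    have [_] := Ux n I; apply => -[y Uy yx]; apply: Uy; apply: xrU.
    by apply: le_ball (ltW nr) _ _; exact: ball_sym.
exists (F n), U; split => //.
Unshelve. all: by end_near. Qed.

Let squeezedC A : squeezed A -> squeezed (setT `\` A).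
Proof.
move=> sA e e0; have [F [U [cF oU FA AU UFe]]] := sA _ e0.
exists (~` U), (~` F); split.
- exact: open_closedC.
- exact: closed_openC.
- by rewrite setTD; apply: subsetC.
- by rewrite setTD; apply: subsetC.
- by rewrite setDE setCK setIC -setDE.
Qed.

Let squeezed_bigcup (A : (set 'rV[R]_N)^nat) :
  (forall n, squeezed (A n)) -> squeezed (\bigcup_n A n).
Proof.
move=> sA e e0.
have /choice[F /choice[U FU]] : forall i, exists F U, [/\ closed F, open U,
    F `<=` A i, A i `<=` U & mu (U `\` F) < (e / 2 / (2 ^ i.+1)%:R)%:E].
  by move=> i; apply: sA; rewrite !divr_gt0// ltr0n expn_gt0.
pose G n := \big[setU/set0]_(i < n) F i.
have cG n : closed (G n) by apply: closed_bigsetU => i _; have [] := FU i.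
have oU : open (\bigcup_n U n) by apply: bigcup_open => i _; have [] := FU i.
have mUF i : measurable (U i `\` F i).
  by have [? ? _ _ _] := FU i; apply: measurableD;
    [exact: measurable_open_rV|exact: measurable_closed_rV].
have [n Gn] : exists n, mu (\bigcup_n U n `\` G n) < e%:E.
  apply: eventually_small.
  - by move=> n; apply: measurableD; [exact: measurable_open_rV|exact: measurable_closed_rV].
  - by move=> m n mn; apply/subsetPset; apply: setDS; exact: subset_bigsetU.
  - apply: (@le_lt_trans _ _ (\sum_(i <oo) (e / 2 / (2 ^ i.+1)%:R)%:E)).
      apply: (@le_trans _ _ (\sum_(i <oo) mu (U i `\` F i))); last first.
        by apply: lee_nneseries => // i _; apply: ltW; have [] := FU i.
      apply: measure_sigma_subadditive => //.
        by apply: bigcapT_measurable => n; apply: measurableD;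
          [exact: measurable_open_rV|exact: measurable_closed_rV].
      move=> x Dx; have [[i _ Ux] _] := Dx 0%N I.
      exists i => //; split => // Fx; have [_] := Dx i.+1 I; apply.
      by rewrite /G -bigcup_mkord; exists i => /=.
    apply: le_lt_trans (@epsilon_trick0 R (e / 2)%R xpredT _) _.
      by rewrite divr_ge0// ltW.
    by rewrite lte_fin ltr_pdivrMr// ltr_pMr// ltr1n.
exists (G n), (\bigcup_n U n); split => //.
- move=> x; rewrite /G -bigcup_mkord => -[i _ Fx]; exists i => //.
  by have [_ _ + _ _] := FU i; apply.
- move=> x [i _ Ax]; exists i => //; by have [_ _ _ + _] := FU i; apply.
Qed.

(** The sets squeezed between a closed and an open set with small difference
    form a sigma-algebra. It contains every open set, which is the increasing
    union of the closed sets of its points at distance at least [n^-1] from the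
    complement. *)
Lemma outer_regular_rV (A : set 'rV[R]_N) (e : R) : measurable A -> (0 < e)%R ->
  exists U : set 'rV[R]_N, [/\ open U, A `<=` U & mu (U `\` A) < e%:E].
Proof.
move=> mA; have : squeezed A.
  have : sigma_algebra setT squeezed.
    split; [|exact: squeezedC|exact: squeezed_bigcup].
    by apply: squeezed_open; exact: open0.
  by move=> /(@smallest_sub _ (sigma_algebra setT) open) /(_ squeezed_open); exact.
move=> /[apply] -[F [U [cF oU FA AU UF]]]; exists U; split => //.
apply: le_lt_trans UF; apply: le_measure; rewrite ?inE.
- by apply: measurableD => //; exact: measurable_open_rV.
- by apply: measurableD; [exact: measurable_open_rV|exact: measurable_closed_rV].
- exact: setDS.
Qed.

End regularity.

Section dyadic_comparison.
Context {R : realType} {N : nat}.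
Implicit Types (x y : 'rV[R]_N) (U A : set 'rV[R]_N).

(** Dyadic cubes are the fibres of this map, which makes those of a given
    generation disjoint and covering by construction. *)
Definition dyadic_index k x : 'rV[int]_N :=
  (\row_i Num.floor (2 ^+ k * x ord0 i))%R.

Definition dyadic_cube k (z : 'rV[int]_N) : set 'rV[R]_N :=
  [set x | dyadic_index k x = z].

Definition dyadic_side k (z : 'rV[int]_N) (i : 'I_N) : set (measurableTypeR R) :=
  `[((z ord0 i)%:~R / 2 ^+ k)%R, ((z ord0 i + 1)%:~R / 2 ^+ k)%R[%classic.

Lemma dyadic_cubeE k z : dyadic_cube k z =
  [set x : 'rV[R]_N | forall i, dyadic_side k z i (x ord0 i)].
Proof.
apply/seteqP; split => x /= xz; first move=> i.
  rewrite -xz /dyadic_side mxE/= in_itv/= ler_pdivrMr ?exprn_gt0// ltr_pdivlMr ?exprn_gt0//.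
  by rewrite mulrC floor_itv.
suff: forall i, Num.floor (2 ^+ k * x ord0 i)%R = z ord0 i.
  by move=> h; apply/rowP => j; rewrite mxE.
move=> i; apply/eqP; rewrite floor_eq; have := xz i.
by rewrite /dyadic_side/= in_itv/= ler_pdivrMr ?exprn_gt0// ltr_pdivlMr ?exprn_gt0// mulrC.
Qed.

Lemma measurable_dyadic_cube k z : measurable (dyadic_cube k z).
Proof.
by rewrite dyadic_cubeE; apply: measurable_box_rV => i; exact: measurable_itv.
Qed.

Lemma lebesgue_dyadic_cube k z :
  lebesgue_rV (dyadic_cube k z) = ((2 ^- k) ^+ N)%:E :> \bar R.
Proof.
rewrite dyadic_cubeE lebesgue_rV_box; last by move=> i; exact: measurable_itv.
transitivity (\prod_(i < N) (2 ^- k : R)%:E).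
  apply: eq_bigr => i _; rewrite /dyadic_side lebesgue_measure_itv/= lte_fin.
  rewrite ltr_pM2r ?invr_gt0 ?exprn_gt0// ltr_int ltrDl ltr01.
  by rewrite -EFinB -mulrBl -intrB addrAC subrr add0r mul1r.
by rewrite prodEFin prodr_const card_ord.
Qed.

Lemma dyadic_cube_dist k z x y : dyadic_cube k z x -> dyadic_cube k z y ->
  (`|x - y| <= 2 ^- k)%R.
Proof.
rewrite !dyadic_cubeE /= => xz yz; apply/rV_norm_leP => [|i].
  by rewrite invr_ge0 exprn_ge0.
have := xz i; have := yz i; rewrite /dyadic_side/= !mxE !in_itv/= !intrD !mulrDl mul1r ler_norml.
by move=> /andP[? ?] /andP[? ?]; apply/andP; split; lra.
Qed.

Lemma dyadic_cubeS k x y : dyadic_index k.+1 x = dyadic_index k.+1 y ->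
  dyadic_index k x = dyadic_index k y.
Proof.
suff dbl (a b : R) : Num.floor (2 * a)%R = Num.floor (2 * b)%R ->
    (Num.floor a <= Num.floor b)%R.
  move=> /rowP xy; apply/rowP => i; have := xy i.
  rewrite !mxE exprS -!mulrA => h.
  by apply/eqP; rewrite eq_le !dbl.
move=> ab; rewrite floor_ge_int.
have : ((2 * Num.floor a)%:~R <= 2 * b)%R.
  by rewrite -floor_ge_int -ab floor_ge_int intrM ler_pM2l// floor_le.
by rewrite intrM ler_pM2l.
Qed.

Section comparison.
Variables m1 m2 : {measure set 'rV[R]_N -> \bar R}.
Hypothesis m12 : forall k z, m1 (dyadic_cube k z) <= m2 (dyadic_cube k z).
Hypothesis m2_fin : forall n : nat, m2 (ball 0%R n%:R) < +oo.

(* the union of the cubes of generation [k] contained in [U]; [inner_piece]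
   enumerates these cubes, with [set0] for the other codes *)
Let inner k U : set 'rV[R]_N := [set x | dyadic_cube k (dyadic_index k x) `<=` U].

Let inner_piece k U n : set 'rV[R]_N :=
  if pickle_inv n is Some z then
    if `[< dyadic_cube k z `<=` U >] then dyadic_cube k z else set0
  else set0.

Let innerE k U : inner k U = \bigcup_n inner_piece k U n.
Proof.
apply/seteqP; split => [x /= xU|x [n _]].
  exists (pickle (dyadic_index k x)) => //; rewrite /inner_piece pickleK_inv.
  by move/asboolP : xU => ->.
rewrite /inner_piece; case: pickle_inv => // z; case: ifPn => // /asboolP zU xz.
by rewrite /inner /= xz.
Qed.

Let measurable_inner_piece k U n : measurable (inner_piece k U n).
Proof.
rewrite /inner_piece; case: pickle_inv => // z; case: ifPn => // _.
exact: measurable_dyadic_cube.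
Qed.

Let trivIset_inner_piece k U : trivIset setT (inner_piece k U).
Proof.
apply/trivIsetP => i j _ _ ij; apply/seteqP; split => // x [].
rewrite /inner_piece.
have := @pickle_invK 'rV[int]_N i; have := @pickle_invK 'rV[int]_N j.
case: pickle_inv => //= z zj; case: pickle_inv => //= w wi.
case: ifPn => // _; case: ifPn => // _; rewrite /dyadic_cube/= => -> wz.
by move: ij; rewrite -wi -zj wz eqxx.
Qed.

Let measurable_inner k U : measurable (inner k U).
Proof. by rewrite innerE; exact: bigcupT_measurable. Qed.

Let le_inner k U : m1 (inner k U) <= m2 (inner k U).
Proof.
rewrite innerE !measure_bigcup//; apply: lee_nneseries => // n _.
rewrite /inner_piece; case: pickle_inv => [z|]; last by rewrite !measure0.
by case: ifPn => _; rewrite ?measure0.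
Qed.

Let bigcup_inner U : open U -> U = \bigcup_k inner k U.
Proof.
move=> oU; apply/seteqP; split => [x Ux|x [k _]]; last exact.
have /nbhs_ballP[r /= r0 xrU] : nbhs x U by exact: open_nbhs_nbhs.
have [k kr] : exists k, (2 ^- k < r :> R)%R.
  near \oo => k; exists k; near: k.
  have := @near_infty_natSinv_expn_lt R (PosNum r0).
  by apply: filterS => n; rewrite div1r.
exists k => // y /= yx; apply: xrU; rewrite mx_norm_ball /ball_ /=.
by apply: le_lt_trans kr; apply: (@dyadic_cube_dist _ (dyadic_index k x)).
Unshelve. all: by end_near. Qed.

Let nd_inner U : nondecreasing_seq (inner ^~ U).
Proof.
apply/nondecreasing_seqP => k; apply/subsetPset => x xU y /=.
by move=> /dyadic_cubeS; rewrite -/(dyadic_cube _ _ _); exact: xU.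
Qed.

Let le_bigcup (F : (set 'rV[R]_N)^nat) : (forall n, measurable (F n)) ->
  nondecreasing_seq F -> (forall n, m1 (F n) <= m2 (F n)) ->
  m1 (\bigcup_n F n) <= m2 (\bigcup_n F n).
Proof.
move=> mF nF F12.
have mUF : measurable (\bigcup_n F n) by exact: bigcupT_measurable.
have c1 := nondecreasing_cvg_mu (mu := m1) mF mUF nF.
have c2 := nondecreasing_cvg_mu (mu := m2) mF mUF nF.
rewrite -(cvg_lim _ c1)// -(cvg_lim _ c2)//; apply: lee_lim.
- by apply/cvg_ex; exists (m1 (\bigcup_n F n)).
- by apply/cvg_ex; exists (m2 (\bigcup_n F n)).
- exact: nearW.
Qed.

Let le_open U : open U -> m1 U <= m2 U.
Proof. by move=> oU; rewrite (bigcup_inner oU); exact: le_bigcup. Qed.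

(** An open set is the increasing union, over the generations, of the dyadic
    cubes that it contains; outer regularity extends the comparison from open
    to Borel sets. *)
Lemma le_measure_dyadic A : measurable A -> m1 A <= m2 A.
Proof.
move=> mA; pose B n : set 'rV[R]_N := ball (0%R : 'rV[R]_N) n%:R.
have oB n : open (B n) by exact: ball_open.
have mB n : measurable (B n) by exact: measurable_open_rV.
have -> : A = \bigcup_n (A `&` B n) by rewrite -setI_bigcupr bigcup_ball_rV setIT.
apply: le_bigcup => [n|m n mn|n]; first exact: measurableI.
  by apply/subsetPset; apply: setIS => x; apply: le_ball; rewrite ler_nat.
have mAB : measurable (A `&` B n) by exact: measurableI.
have nu_fin : mrestr m2 (mB n) setT < +oo.
  by rewrite /mrestr setTI; exact: m2_fin.
apply/lee_addgt0Pr => e e0.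
have [U [oU AU Ue]] := outer_regular_rV nu_fin mAB e0.
have mUB : measurable (U `&` B n).
  by apply: measurableI => //; exact: measurable_open_rV.
apply: (@le_trans _ _ (m1 (U `&` B n))).
  apply: le_measure; rewrite ?inE//.
  by move=> x [Ax Bx]; split => //; exact: AU.
apply: (le_trans (le_open (openI oU (oB n)))).
have -> : U `&` B n = (A `&` B n) `|` ((U `\` (A `&` B n)) `&` B n).
  apply/seteqP; split => [x [Ux Bx]|x [[Ax Bx]|[[Ux _] Bx]]] //.
    by have [Ax|nAx] := pselect (A x); [left|right; split => //; split => // -[]].
  by split => //; exact: AU.
have mD : measurable ((U `\` (A `&` B n)) `&` B n).
  by apply: measurableI => //; apply: measurableD => //; exact: measurable_open_rV.
apply: (@le_trans _ _ (m2 (A `&` B n) + m2 ((U `\` (A `&` B n)) `&` B n))).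
  by apply: measureU2 => //.
by apply: leeD => //; exact: ltW.
Qed.

End comparison.
End dyadic_comparison.

Section expanding_maps.
Context {R : realType} {N : nat}.
Variables (L : R) (f : 'rV[R]_N -> 'rV[R]_N).
Hypothesis mf : measurable_fun [set: 'rV[R]_N] f.
Hypothesis fL : forall x y, (`|x - y| <= L * `|f x - f y|)%R.
Hypothesis L0 : (0 <= L)%R.

Let measurable_preimage A : measurable A -> measurable (f @^-1` A).
Proof. by move=> mA; rewrite -[X in measurable X]setTI; exact: mf. Qed.

Lemma lebesgue_ball_fin (n : nat) : lebesgue_rV (ball (0%R : 'rV[R]_N) n%:R) < +oo.
Proof.
pose I (i : 'I_N) : set (measurableTypeR R) := `[(- n%:R)%R, n%:R%R]%classic.
have mI i : measurable (I i) by exact: measurable_itv.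
apply: (@le_lt_trans _ _
    (lebesgue_rV [set v : 'rV[R]_N | forall i, I i (v ord0 i)])).
  apply: le_measure; rewrite ?inE.
  - by apply: measurable_open_rV; exact: ball_open.
  - exact: measurable_box_rV.
  - move=> v; rewrite mx_norm_ball /ball_/= sub0r normrN => /ltW vn i.
    by rewrite /I/= in_itv/= -ler_norml; apply: le_trans (coord_le_norm _ _) vn.
rewrite lebesgue_rV_box// (eq_bigr (fun=> (n%:R + n%:R)%:E)); last first.
  move=> i _; rewrite /I lebesgue_measure_itv/= lte_fin -EFinB opprK.
  case: ifPn => //; rewrite -leNgt => n0; congr EFin.
  by apply/esym/eqP; rewrite paddr_eq0// andbb eq_le ler0n andbT; lra.
by rewrite prodEFin ltry.
Qed.

(** A cube of side [r] has sup-norm diameter [r], so its preimage lies in a box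
    with sides at most [L * r]: the preimage map multiplies the measure of
    cubes, hence of all Borel sets, by at most [L ^ N]. *)
Lemma lebesgue_preimage_expanding A : measurable A ->
  lebesgue_rV (f @^-1` A) <= (L ^+ N)%:E * lebesgue_rV A.
Proof.
have LN0 : (0 <= L ^+ N)%R by exact: exprn_ge0.
pose m1 : {measure set _ -> \bar R} :=
  measure_function_pushforward__canonical__measure_function_Measure
    (@lebesgue_rV R N) mf.
pose m2 : {measure set _ -> \bar R} := mscale (NngNum LN0) (@lebesgue_rV R N).
apply: (@le_measure_dyadic _ _ m1 m2) => [k z|n]; last first.
  by apply: lte_mul_pinfty => //; exact: lebesgue_ball_fin.
change (lebesgue_rV (f @^-1` dyadic_cube k z) <=
  (L ^+ N)%:E * lebesgue_rV (dyadic_cube k z)).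
have [->|/set0P[x0 x0z]] := eqVneq (f @^-1` dyadic_cube k z) set0.
  by rewrite measure0 mule_ge0.
pose r : R := (2 ^- k)%R.
have r0 : (0 <= r)%R by rewrite invr_ge0 exprn_ge0.
have Lr0 : (0 <= L * r)%R by rewrite mulr_ge0.
have diam x y : dyadic_cube k z (f x) -> dyadic_cube k z (f y) ->
    forall i, (`|x ord0 i - y ord0 i| <= L * r)%R.
  move=> xz yz i; have := coord_le_norm (x - y)%R i; rewrite !mxE => /le_trans; apply.
  by apply: le_trans (fL x y) _; rewrite ler_wpM2l//; exact: dyadic_cube_dist xz yz.
(* projections of the preimage: the box is built on their infima *)
pose S (i : 'I_N) : set R := [set x ord0 i | x in f @^-1` dyadic_cube k z].
pose a i : R := inf (S i).
have aS x i : dyadic_cube k z (f x) -> (a i <= x ord0 i <= a i + L * r)%R.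
  move=> xz; apply/andP; split.
    apply: ge_inf; last by exists x.
    exists (x0 ord0 i - L * r)%R => _ [y yz <-].
    by have := diam _ _ x0z yz i; rewrite ler_norml => /andP[_ ?]; lra.
  rewrite -lerBlDr; apply: lb_le_inf; first by exists (x0 ord0 i), x0.
  move=> _ [y yz <-].
  by have := diam _ _ xz yz i; rewrite ler_norml => /andP[_ ?]; lra.
pose I i : set (measurableTypeR R) := `[a i, (a i + L * r)%R]%classic.
have mI i : measurable (I i) by exact: measurable_itv.
apply: (@le_trans _ _ (lebesgue_rV [set v : 'rV[R]_N | forall i, I i (v ord0 i)])).
  apply: le_measure; rewrite ?inE.
  - by apply: measurable_preimage; exact: measurable_dyadic_cube.
  - exact: measurable_box_rV.
  - by move=> x xz i; rewrite /I/= in_itv/=; exact: aS.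
rewrite lebesgue_rV_box// lebesgue_dyadic_cube -EFinM -exprMn.
apply: (@le_trans _ _ (\prod_(i < N) (L * r)%:E)); last first.
  by rewrite prodEFin prodr_const card_ord.
rewrite le_eqVlt; apply/orP; left; apply/eqP; apply: eq_bigr => i _.
rewrite /I lebesgue_measure_itv/= lte_fin; case: ifPn => [_|].
  by rewrite -EFinB addrAC subrr add0r.
by rewrite ltrDl -leNgt => Lr; congr EFin; apply/eqP; rewrite eq_le Lr0 Lr.
Qed.

Lemma ge0_integral_expanding (g : 'rV[R]_N -> \bar R) :
  measurable_fun [set: 'rV[R]_N] g -> (forall x, 0 <= g x) ->
  \int[lebesgue_rV]_x g (f x) <= (L ^+ N)%:E * \int[lebesgue_rV]_x g x.
Proof.
move=> mg g0; have LN0 : (0 <= L ^+ N)%R by exact: exprn_ge0.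
pose m1 : {measure set _ -> \bar R} :=
  measure_function_pushforward__canonical__measure_function_Measure
    (@lebesgue_rV R N) mf.
pose m2 : {measure set _ -> \bar R} := mscale (NngNum LN0) (@lebesgue_rV R N).
have := @ge0_integral_pushforward _ _ _ _ R f mf (@lebesgue_rV R N) setT g
  measurableT mg (fun y _ => g0 y).
rewrite preimage_setT => /= <-.
have -> : (L ^+ N)%:E * \int[lebesgue_rV]_x g x = \int[m2]_x g x.
  by rewrite ge0_integral_mscale.
apply: (@ge0_le_measure_integral _ _ _ m1 m2) => // S mS.
exact: lebesgue_preimage_expanding.
Qed.

End expanding_maps.

Section translations.
Context {R : realType} {N : nat}.
Implicit Types (a : 'rV[R]_N) (g : 'rV[R]_N -> \bar R).

(** Translations in both directions satisfy the expansion bound with [L = 1]. *)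
Lemma ge0_integral_translation a g :
  measurable_fun [set: 'rV[R]_N] g -> (forall x, 0 <= g x) ->
  \int[lebesgue_rV]_x g (x + a)%R = \int[lebesgue_rV]_x g x.
Proof.
have le b h : measurable_fun [set: 'rV[R]_N] h -> (forall x, 0 <= h x) ->
    \int[lebesgue_rV]_x h (x + b)%R <= \int[lebesgue_rV]_x h x.
  move=> mh h0; have := @ge0_integral_expanding R N 1%R (fun x => x + b)%R.
  rewrite expr1n => /(_ _ _ ler01 h mh h0); rewrite mul1e; apply => [|x y].
    exact: measurable_fun_addr_rV.
  by rewrite mul1r opprD addrACA subrr addr0.
move=> mg g0; apply/eqP; rewrite eq_le le//=.
have mga : measurable_fun [set: 'rV[R]_N] (fun x => g (x + a)%R).
  by apply: (measurableT_comp mg); exact: measurable_fun_addr_rV.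
have := le (- a)%R _ mga (fun x => g0 _); under eq_integral do rewrite addrNK.
by [].
Qed.

End translations.

(** * The coarea formula and the Cheeger inequality *)

Section perimeter_bound.
Context {R : realType} {N : nat}.
Implicit Types (s : R) (u v : 'rV[R]_N -> R) (Omega E : set 'rV[R]_N).

Lemma Ws1_seminorm_ge0 s u : 0 <= Ws1_seminorm s u.
Proof.
apply: integral_ge0 => x _; apply: integral_ge0 => y _.
by rewrite lee_fin divr_ge0// powR_ge0.
Qed.

Lemma cheeger_constant_ge0 s Omega : 0 <= cheeger_constant s Omega.
Proof.
apply/ereal_infP => _ [E _ <-]; rewrite /cheeger_ratio mule_ge0//.
  exact: Ws1_seminorm_ge0.
by rewrite inve_ge0.
Qed.

Lemma EFin_inv (r : R) : (0 < r)%R -> (r%:E)^-1 = (r^-1)%:E.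
Proof. by move=> r0; rewrite inver gt_eqF. Qed.

Lemma lebesgue_bounded_fin Omega : measurable Omega -> bounded_set Omega ->
  lebesgue_rV Omega < +oo.
Proof.
move=> mO [M [_ MO]].
pose n := (Num.truncn (`|M| + 1)).+1.
apply: (@le_lt_trans _ _ (lebesgue_rV (ball (0%R : 'rV[R]_N) n%:R))); last first.
  exact: lebesgue_ball_fin.
apply: le_measure; rewrite ?inE//.
  by apply: measurable_open_rV; exact: ball_open.
move=> x Ox; rewrite mx_norm_ball /ball_/= sub0r normrN.
apply: (@le_lt_trans _ _ (`|M| + 1)%R); last by rewrite truncnS_gt.
by apply: MO => //; rewrite ltr_pwDr// ler_norm.
Qed.

Lemma cheeger_le_perimeter s Omega E : measurable E -> E `<=` Omega ->
  lebesgue_rV E < +oo ->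
  cheeger_constant s Omega * lebesgue_rV E <= s_perimeter s E.
Proof.
move=> mE EO Efin; have [->|E0] := eqVneq (lebesgue_rV E) 0.
  by rewrite mule0 Ws1_seminorm_ge0.
have E_gt0 : 0 < lebesgue_rV E by rewrite lt0e E0/=.
have /ereal_inf_lbound : (cheeger_ratio s @` cheeger_admissible Omega)
    (cheeger_ratio s E) by exists E.
rewrite -/(cheeger_constant s Omega) /cheeger_ratio.
move: E_gt0 Efin; case: (lebesgue_rV E) => // r; rewrite lte_fin => r0 _.
by rewrite EFin_inv// lee_pdivlMr.
Qed.

(** The almost-everywhere hypothesis is iterated because the seminorm is defined
    by an iterated integral. *)
Lemma le_Ws1_seminorm_ae s u v : measurable_fun [set: 'rV[R]_N] u ->
  measurable_fun [set: 'rV[R]_N] v ->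
  {ae lebesgue_rV, forall x, {ae lebesgue_rV, forall y,
    (`|u x - u y| <= `|v x - v y|)%R}} ->
  Ws1_seminorm s u <= Ws1_seminorm s v.
Proof.
move=> mu mv uv; rewrite !Ws1_seminormE.
apply: ge0_le_iterated_integral; try exact: measurable_Ws1_integrand;
  try exact: Ws1_integrand_ge0.
apply: filterS uv => x; apply: filterS => y uvxy.
by rewrite lee_fin ler_wpM2r// gagliardo_kernel_ge0.
Qed.

End perimeter_bound.

Section coarea.
Context {R : realType} {N : nat}.
Variables (s : R) (Omega : set 'rV[R]_N).
Hypothesis oOmega : open Omega.
Hypothesis bOmega : bounded_set Omega.
Variable u : 'rV[R]_N -> R.
Hypothesis Wu : calW s Omega u.

Let mOmega : measurable Omega. Proof. exact: measurable_open_rV. Qed.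

Let mu : measurable_fun [set: 'rV[R]_N] u. Proof. by case: Wu => -[]. Qed.

Let v x : R := (\1_Omega x * `|u x|)%R.

Let mv : measurable_fun [set: 'rV[R]_N] v.
Proof.
by apply: measurable_funM; [exact: measurable_indic|exact: measurableT_comp].
Qed.

(** The condition [0 <= t] lets [t] range over the whole line in the coarea
    formula. *)
Definition level (t : R) : set 'rV[R]_N :=
  [set x | (0 <= t)%R /\ superlevel Omega u t x].

Let Z : set (measurableTypeR R * 'rV[R]_N) := [set p | level p.1 p.2].

Let mZ : measurable Z.
Proof.
rewrite (_ : Z = (fst @^-1` `[0%R, +oo[%classic) `&`
    ((snd @^-1` Omega) `&`
    [set p : measurableTypeR R * 'rV[R]_N | (p.1 < `|u p.2|)%R])); last first.
  by apply/seteqP; split => -[t x]; rewrite /Z /level /superlevel /=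
    ?in_itv/= andbT => -[? []].
apply: measurableI.
  rewrite -[X in measurable X]setTI; apply: measurable_fst => //.
apply: measurableI.
  by rewrite -[X in measurable X]setTI; apply: measurable_snd.
rewrite -[X in measurable X]setTI.
have : measurable_fun [set: measurableTypeR R * 'rV[R]_N]
    (fun p => (p.1 < `|u p.2|)%R).
  apply: measurable_fun_ltr; first exact: measurable_fst.
  apply: measurableT_comp => //; exact: (measurableT_comp mu measurable_snd).
by move=> /(_ measurableT [set true] I).
Qed.

Let F (t : measurableTypeR R) : 'rV[R]_N -> R := \1_(level t).

Let mF : measurable_fun [set: _] (fun p : measurableTypeR R * 'rV[R]_N => F p.1 p.2).
Proof.
rewrite (_ : (fun _ => _) = \1_Z); first exact: measurable_indic.
by apply/funext => -[t x]; rewrite /F !indicE; congr (nat_of_bool _)%:R;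
  apply/idP/idP; rewrite !inE.
Qed.

Lemma measurable_level t : measurable (level t).
Proof.
apply/(measurable_indicP R); exact: (measurable_fun_pair2 t mF).
Qed.

Let FE t x : F t x = ((0 <= t < v x)%R)%:R.
Proof.
rewrite /F indicE; congr (nat_of_bool _)%:R; rewrite /v indicE.
have [xO|xO] := boolP (x \in Omega).
  rewrite mul1r; apply/idP/andP; rewrite inE.
    by move=> [-> []].
  by move=> [t0 tu]; split => //; split => //; exact: set_mem.
rewrite mul0r; apply/idP/andP; rewrite inE.
  by move=> [_ [/mem_set]]; rewrite (negbTE xO).
by move=> [t0 /(le_lt_trans t0)]; rewrite ltxx.
Qed.

Let v_ge0 x : (0 <= v x)%R. Proof. by rewrite mulr_ge0. Qed.

Let integral_layers (a b : R) : (0 <= a)%R -> (0 <= b)%R ->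
  \int[lebesgue_measure]_t
    (`|((0 <= t < a)%R)%:R - ((0 <= t < b)%R)%:R|%R)%:E = (`|a - b|%R)%:E :> \bar R.
Proof.
move=> a0 b0; wlog ab : a b a0 b0 / (a <= b)%R.
  move=> H; have [/H->//|/ltW/H] := leP a b.
  rewrite distrC => <- //; apply: eq_integral => t _; by rewrite distrC.
transitivity (\int[lebesgue_measure]_t (\1_(`[a, b[%classic) t)%:E : \bar R).
  apply: eq_integral => t _; congr EFin; rewrite indicE mem_setE in_itv/=.
  have [t0|t0] := leP 0%R t => /=; last first.
    by rewrite subrr normr0 leNgt (lt_le_trans t0).
  have [ta|ta] := ltP t a => /=; first by rewrite (lt_le_trans ta ab) subrr normr0.
  by rewrite sub0r normrN; case: (t < b)%R; rewrite ?normr1 ?normr0.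
rewrite integral_indic// setIT [LHS]lebesgue_measure_itv/= lte_fin.
case: ltgtP ab => // [ab|->] _; last by rewrite subrr normr0.
by rewrite -EFinB distrC gtr0_norm// subr_gt0.
Qed.

Let integral_level_diff x y :
  \int[lebesgue_measure]_t (`|F t x - F t y|%R)%:E = (`|v x - v y|%R)%:E :> \bar R.
Proof.
rewrite -integral_layers//; apply: eq_integral => t _; by rewrite !FE.
Qed.

Let integral_level x : \int[lebesgue_measure]_t (F t x)%:E = (v x)%:E :> \bar R.
Proof.
rewrite -[in RHS](ger0_norm (v_ge0 x)) -[in RHS](subr0 (v x)) -integral_layers//.
apply: eq_integral => t _; rewrite FE; congr EFin.
have -> : (0 <= t < 0)%R = false by apply/negP => /andP[/le_lt_trans /[apply]]; rewrite ltxx.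
by rewrite subr0 ger0_norm.
Qed.

(** Coarea formula: superpose the layers
    [|a - b| = int_0^oo |1_(t < a) - 1_(t < b)| dt]. *)
Lemma integral_perimeter_level :
  \int[lebesgue_measure]_t s_perimeter s (level t) = Ws1_seminorm s v.
Proof.
rewrite (integral_Ws1_seminorm _ mF).
apply: eq_integral => x _; apply: eq_integral => y _.
by rewrite integral_level_diff -EFinM.
Qed.

Lemma L1norm_level :
  L1norm Omega u = \int[lebesgue_measure]_t lebesgue_rV (level t).
Proof.
transitivity (\int[lebesgue_rV]_x (v x)%:E).
  rewrite /L1norm integral_mkcond; apply: eq_integral => x _.
  by rewrite patchE /v indicE; case: ifPn => _; rewrite ?mul1r ?mul0r.
under eq_integral do rewrite -integral_level.
have F0 p : 0 <= (F p.1 p.2)%:E by rewrite lee_fin.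
have mEF : measurable_fun [set: measurableTypeR R * 'rV[R]_N]
  (fun p => (F p.1 p.2)%:E) by exact/measurable_EFinP.
rewrite -(fubini_tonelli _ mEF F0); apply: eq_integral => t _.
by rewrite /= /F integral_indic// ?setIT//; exact: measurable_level.
Qed.

Lemma le_Ws1_seminorm_trunc : Ws1_seminorm s v <= Ws1_seminorm s u.
Proof.
have vu : {ae lebesgue_rV, forall x, v x = `|u x|%R}.
  have [_ _] := Wu.1; apply: filterS => x ux; rewrite /v indicE.
  have [_|] := boolP (x \in Omega); first by rewrite mul1r.
  by rewrite notin_setE => /ux ->; rewrite normr0 mulr0.
apply: le_Ws1_seminorm_ae => //.
apply: filterS (vu) => x vx; apply: filterS (vu) => y vy.
by rewrite vx vy; exact: ler_dist_dist.
Qed.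

Let level_fin t : lebesgue_rV (level t) < +oo.
Proof.
apply: le_lt_trans (lebesgue_bounded_fin mOmega bOmega).
by apply: le_measure; rewrite ?inE//; [exact: measurable_level|move=> x [_ []]].
Qed.

Let m_perimeter : measurable_fun [set: measurableTypeR R]
  (fun t => s_perimeter s (level t)).
Proof. exact: (measurable_Ws1_seminorm_family mF). Qed.

Let m_volume : measurable_fun [set: measurableTypeR R]
  (fun t => lebesgue_rV (level t)).
Proof.
have F0 p : 0 <= (F p.1 p.2)%:E by rewrite lee_fin.
have mEF : measurable_fun [set: measurableTypeR R * 'rV[R]_N]
  (fun p => (F p.1 p.2)%:E) by exact/measurable_EFinP.
have := measurable_fun_fubini_tonelli_F (m2 := @lebesgue_rV R N) _ mEF F0.
apply: eq_measurable_fun => t _; rewrite /fubini_F /F/= integral_indic ?setIT//.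
exact: measurable_level.
Qed.

Lemma cheeger_le_level t :
  cheeger_constant s Omega * lebesgue_rV (level t) <= s_perimeter s (level t).
Proof.
apply: cheeger_le_perimeter => //; first exact: measurable_level.
by move=> x [_ []].
Qed.

Lemma integral_cheeger_level : \int[lebesgue_measure]_t
  (cheeger_constant s Omega * lebesgue_rV (level t)) =
  cheeger_constant s Omega * L1norm Omega u.
Proof.
by rewrite L1norm_level ge0_integralZl//; exact: cheeger_constant_ge0.
Qed.

(** Integrate [h |E_t| <= P_s(E_t)] over [t]. *)
Lemma cheeger_seminorm :
  cheeger_constant s Omega * L1norm Omega u <= Ws1_seminorm s u.
Proof.
apply: le_trans le_Ws1_seminorm_trunc.
rewrite -integral_perimeter_level -integral_cheeger_level.
apply: ge0_le_integral => //.
- by move=> t _; rewrite mule_ge0//; exact: cheeger_constant_ge0.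
- exact: measurable_funeM.
- by move=> t _; exact: cheeger_le_level.
Qed.

Hypothesis u_neq0 : ~ {ae lebesgue_rV, forall x, u x = 0%R}.

Lemma L1norm_gt0 : 0 < L1norm Omega u.
Proof.
rewrite lt0e; apply/andP; split; last by exact: integral_ge0.
apply/eqP => L0; apply: u_neq0.
have : \int[lebesgue_rV]_(x in Omega) `|(u x)%:E| = 0 by [].
move=> /ae_eq_integral_abs; move=> /(_ mOmega) H.
have /H : measurable_fun Omega (EFin \o u).
  by apply/measurable_EFinP; exact: measurable_funS mu.
have [[_ _ +] _] := Wu; apply: filterS2 => x u0 uO.
by have [/uO[]|/u0] := pselect (Omega x).
Qed.

Lemma L1norm_fin : L1norm Omega u < +oo.
Proof. by have [[_ /integrableP[]]] := Wu. Qed.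

Lemma cheeger_le_quotient :
  cheeger_constant s Omega <= Ws1_seminorm s u / L1norm Omega u.
Proof.
have := cheeger_seminorm; move: L1norm_gt0 L1norm_fin.
case: (L1norm _ _) => // r; rewrite lte_fin => r0 _.
by rewrite EFin_inv// lee_pdivlMr.
Qed.

(** Equality propagates through the chain of inequalities: the nonnegative gap
    [P_s(E_t) - h |E_t|] has zero integral. *)
Lemma cheeger_set_superlevel :
  Ws1_seminorm s u / L1norm Omega u = cheeger_constant s Omega ->
  {ae lebesgue_measure, forall t : R, (0 < t)%R ->
    0 < lebesgue_rV (superlevel Omega u t) ->
    cheeger_set s Omega (superlevel Omega u t)}.
Proof.
move=> Eq.
have [r r0 Lr] : exists2 r, (0 < r)%R & L1norm Omega u = r%:E.
  move: L1norm_gt0 L1norm_fin; case: (L1norm _ _) => // r.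
  by rewrite lte_fin => r0 _; exists r.
have [w Ww] : exists w, Ws1_seminorm s u = w%:E.
  have := Ws1_seminorm_ge0 s u; have := Wu.2; case: (Ws1_seminorm _ _) => // w.
  by exists w.
have hE : cheeger_constant s Omega = (w / r)%:E.
  by rewrite -Eq Lr Ww EFin_inv.
pose G t := s_perimeter s (level t).
pose H t := cheeger_constant s Omega * lebesgue_rV (level t).
have H0 t : 0 <= H t by rewrite mule_ge0//; exact: cheeger_constant_ge0.
have G0 t : 0 <= G t by exact: Ws1_seminorm_ge0.
have HG t : H t <= G t by exact: cheeger_le_level.
have mH : measurable_fun [set: measurableTypeR R] H by exact: measurable_funeM.
have IH : \int[lebesgue_measure]_t H t = w%:E.
  by rewrite integral_cheeger_level hE Lr -EFinM divfK// gt_eqF.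
have IG : \int[lebesgue_measure]_t G t = w%:E.
  apply/eqP; rewrite eq_le; apply/andP; split.
    by rewrite -Ww /G integral_perimeter_level le_Ws1_seminorm_trunc.
  by rewrite -IH; apply: ge0_le_integral.
have iH : lebesgue_measure.-integrable setT H.
  apply/integrableP; split => //.
  by under eq_integral do rewrite gee0_abs//; rewrite IH ltry.
have iG : lebesgue_measure.-integrable setT G.
  apply/integrableP; split => //.
  by under eq_integral do rewrite gee0_abs//; rewrite IG ltry.
have H_fin t : H t \is a fin_num.
  rewrite ge0_fin_numE// /H hE lte_mul_pinfty//.
  by rewrite -hE cheeger_constant_ge0.
have : \int[lebesgue_measure]_t `|G t - H t| = 0.
  under eq_integral do rewrite gee0_abs ?sube_ge0 ?H_fin ?orbT//.
  by rewrite integralB// IG IH subee.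
move=> /ae_eq_integral_abs => /(_ measurableT (emeasurable_funB m_perimeter mH)).
apply: filterS => t /(_ I) GH t0 Et0.
have Elevel : level t = superlevel Omega u t.
  by apply/seteqP; split => x; [move=> []|split => //; exact: ltW].
rewrite -Elevel in Et0 *; split.
  by split => //; [exact: measurable_level|move=> x [_ []]].
have {}GH : G t = H t.
  by rewrite -[LHS](subeK (G t) (H_fin t)) GH /cst/= add0e.
rewrite /cheeger_ratio -/(G t) GH /H.
move: Et0 (level_fin t); case: (lebesgue_rV _) => // e; rewrite lte_fin => e0 _.
by rewrite EFin_inv// -muleA -EFinM divff ?mule1// gt_eqF.
Qed.

End coarea.

(** * Smooth bumps of one variable *)

Section flat_functions.
Local Close Scope ereal_scope.
Context {R : realType}.
Implicit Types (d t : R).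

Lemma powers_le_expR (n : nat) (y : R) : 0 <= y -> y ^+ n <= n`!%:R * expR y.
Proof.
case: n => [|n] y0; first by rewrite expr0 fact0 mul1r -expR0 ler_expR.
rewrite mulrC -ler_pdivrMr ?ltr0n ?fact_gt0//.
by apply: le_trans (expR_ge1Dxn n y0); rewrite lerDr.
Qed.

(** With the exponent [k] as a parameter, the linear span of these functions is
    closed under differentiation; smoothness then needs no formula for higher
    derivatives. *)
Definition flat k t : R := if 0 < t then t^-1 ^+ k * expR (- t^-1) else 0.

Lemma flat_ge0 k t : 0 <= flat k t.
Proof.
rewrite /flat; case: ifPn => // t0.
by rewrite mulr_ge0 ?expR_ge0// exprn_ge0// invr_ge0 ltW.
Qed.

(** [y^(k + n) <= (k + n)! e^y] at [y = t^-1]; the case [n = 0] bounds [flat],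
    the case [n = 2] makes it flat at the origin. *)
Lemma flat_le k n t : flat k t <= (k + n)`!%:R * `|t| ^+ n.
Proof.
rewrite /flat; case: ifPn => [t0|_]; last by rewrite mulr_ge0.
have ti0 : 0 <= t^-1 by rewrite invr_ge0 ltW.
rewrite expRN ler_pdivrMr ?expR_gt0// mulrAC gtr0_norm//.
rewrite -ler_pdivrMr ?exprn_gt0// -exprVn -exprD.
exact: powers_le_expR.
Qed.

Lemma is_derive_quadratic (f : R -> R) (C t : R) :
  (forall z, `|f z - f t| <= C * `|z - t| ^+ 2) -> is_derive t 1 f 0.
Proof.
move=> fC; apply/is_derive1_caratheodory.
exists (fun z => (f z - f t) / (z - t)); split => [z||].
- have [->|zt] := eqVneq z t; first by rewrite !subrr mulr0.
  by rewrite divfK// subr_eq0.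
- change ((fun z => (f z - f t) / (z - t)) @ t --> (f t - f t) / (t - t)).
  rewrite subrr mul0r.
  apply/cvgr0Pnorm_le => e e0.
  have C0 : 0 <= C.
    by have := fC (t + 1); rewrite addrAC subrr add0r normr1 expr1n mulr1; apply: le_trans.
  near=> z; have [->|zt] := eqVneq z t; first by rewrite subrr mul0r normr0 ltW.
  rewrite normrM normfV ler_pdivrMr ?normr_gt0 ?subr_eq0//.
  apply: le_trans (fC z) _; rewrite expr2 mulrA ler_wpM2r//.
  have h : `|z - t| <= e / (C + 1).
    rewrite distrC; near: z; apply: cvgr_dist_le; first exact: cvg_id.
    by rewrite divr_gt0// ltr_wpDl.
  apply: (@le_trans _ _ (C * (e / (C + 1)))); first by rewrite ler_wpM2l.
  by rewrite mulrCA ler_piMr ?(ltW e0)// ler_pdivrMr ?mul1r ?lerDl// ltr_wpDl.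
- by rewrite subrr mul0r.
Unshelve. all: by end_near. Qed.

(** On the closed left half-line the derivative is 0 by the quadratic bound. *)
Lemma is_derive_flat k t :
  is_derive t 1 (flat k) (flat k.+2 t - k%:R * flat k.+1 t).
Proof.
have [t0|t0] := ltP 0 t; last first.
  have f0 j : flat j t = 0 by rewrite /flat ltNge t0.
  rewrite !f0 mulr0 subr0.
  apply: (@is_derive_quadratic _ (k + 2)`!%:R) => z.
  rewrite f0 subr0 ger0_norm ?flat_ge0//.
  have [z0|z0] := ltP 0 z; last by rewrite /flat ltNge z0/= mulr_ge0.
  apply: le_trans (flat_le k 2 z) _; rewrite ler_wpM2l// lerXn2r ?nnegrE//.
  by rewrite !gtr0_norm//; lra.
pose h (y : R) := y ^+ k * expR (- y).
apply: (@near_eq_is_derive _ _ _ (h \o (fun z : R => z^-1))).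
  near=> z; rewrite /h /= /flat ifT//; near: z; exact: lt_nbhsr.
have dh (y : R) : is_derive y 1 h (k%:R * y ^+ k.-1 * expR (- y) - y ^+ k * expR (- y)).
  have d1 : is_derive y 1 (fun y : R => expR (- y)) (expR (- y) * -1).
    exact: (@is_derive1_comp _ expR (fun z => - z) y _ (-1)).
  have := is_deriveM (is_deriveX k (is_derive_id y 1)) d1.
  have -> : (id ^+ k * (fun y : R => expR (- y)))%R = h.
    by apply/funext => z; rewrite /h !fctE.
  move=> H; apply: is_derive_eq H _; rewrite /= /GRing.scale/= fctE.
  rewrite mulr1; ring.
have tn0 : t != 0 by rewrite gt_eqF.
have di : is_derive t 1 (fun z : R => z^-1) (- t ^- 2).
  have := @is_deriveV _ id t 1 1 tn0 (is_derive_id t 1).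
  by move=> H; apply: is_derive_eq H _; rewrite /GRing.scale/= mulr1.
have H := is_derive1_comp (dh t^-1) di.
apply: is_derive_eq H _; rewrite /flat t0.
set E := expR _; case: k {h dh} => [|k]; rewrite /= ?expr0; last first.
  by rewrite -exprVn !exprS; ring.
by rewrite -exprVn !exprS expr0; ring.
Unshelve. all: by end_near. Qed.

(** The span of the products of two flat functions supported in [-d, d]; like
    the span of the flat functions it is closed under differentiation. *)
Inductive flat_bump d : (R -> R) -> Prop :=
| flat_bump_prod j k : flat_bump d (fun t => flat j (d + t) * flat k (d - t))
| flat_bump_add f g : flat_bump d f -> flat_bump d g -> flat_bump d (fun t => f t + g t)
| flat_bump_scale c f : flat_bump d f -> flat_bump d (fun t => c * f t).

Lemma flat_bump_bounded d f : flat_bump d f -> exists2 M, 1 <= M & forall t, `|f t| <= M.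
Proof.
have b k t : `|flat k t| <= k`!%:R.
  rewrite ger0_norm ?flat_ge0//; have := flat_le k 0 t.
  by rewrite addn0 expr0 mulr1.
have max1 (f' : R -> R) M : (forall t, `|f' t| <= M) ->
    exists2 M, 1 <= M & forall t, `|f' t| <= M.
  move=> fM; exists (Num.max 1 M); first by rewrite le_max lexx.
  by move=> t; rewrite le_max fM orbT.
elim=> {f} [j k|f g _ [M _ fM] _ [K _ gK]|c f _ [M _ fM]].
- apply: (max1 _ (j`!%:R * k`!%:R)) => t; rewrite normrM ler_pM//.
- by apply: (max1 _ (M + K)) => t; apply: le_trans (ler_normD _ _) _; rewrite lerD.
- by apply: (max1 _ (`|c| * M)) => t; rewrite normrM ler_wpM2l.
Qed.

Lemma flat_bump_out d f t : flat_bump d f -> d <= `|t| -> f t = 0.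
Proof.
move=> + td; elim=> {f} [j k|f g _ -> _ ->|c f _ ->]; rewrite ?addr0 ?mulr0//.
have [t0|t0] := lerP 0 t.
  by move: td; rewrite ger0_norm// [flat k _]/flat subr_gt0 ltNge => ->; rewrite mulr0.
move: td; rewrite ltr0_norm// [flat j _]/flat => td.
by rewrite ifF ?mul0r//; apply/negbTE; rewrite -leNgt; lra.
Qed.

Lemma flat_bump_derive d f : flat_bump d f ->
  exists2 f', flat_bump d f' & forall t, is_derive t 1 f (f' t).
Proof.
elim=> {f} [j k|f g _ [f' bf ff'] _ [g' bg gg']|c f _ [f' bf ff']].
- exists (fun t => (flat j.+2 (d + t) * flat k (d - t) +
                  (- j%:R) * (flat j.+1 (d + t) * flat k (d - t))) +
           ((-1) * (flat j (d + t) * flat k.+2 (d - t)) +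
             k%:R * (flat j (d + t) * flat k.+1 (d - t)))).
    by do ?apply: flat_bump_add; do ?apply: flat_bump_scale; apply: flat_bump_prod.
  move=> t.
  have dl : is_derive t 1 (fun t => d + t) 1.
    have H := is_deriveD (is_derive_cst d t 1) (is_derive_id t 1).
    by apply: is_derive_eq H _; rewrite add0r.
  have dr : is_derive t 1 (fun t => d - t) (-1).
    have H := is_deriveB (is_derive_cst d t 1) (is_derive_id t 1).
    by apply: is_derive_eq H _; rewrite sub0r.
  have H1 := is_derive1_comp (is_derive_flat j (d + t)) dl.
  have H2 := @is_derive1_comp R (flat k) (fun t => d - t) t _ _
    (is_derive_flat k (d - t)) dr.
  have H := is_deriveM H1 H2.
  apply: is_derive_eq H _; rewrite /GRing.scale/=; ring.
- exists (fun t => f' t + g' t); first exact: flat_bump_add.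
  by move=> t; exact: is_deriveD.
- exists (fun t => c * f' t); first exact: flat_bump_scale.
  by move=> t; exact: is_deriveZ.
Qed.

Lemma flat_bump_lipschitz d f : flat_bump d f ->
  exists2 M, 0 <= M & forall s t, `|f s - f t| <= M * `|s - t|.
Proof.
move=> /flat_bump_derive[f' /flat_bump_bounded[M M1 f'M] ff'].
have M0 : 0 <= M by apply: le_trans M1.
exists M => //.
suff H s t : s <= t -> `|f t - f s| <= M * `|t - s|.
  by move=> s t; have [/H|/ltW/H//] := leP s t; rewrite distrC (distrC s).
move=> st; have [] := @MVT_segment R f f' s t st (fun x _ => ff' x).
  apply: continuous_subspaceT => x; apply: differentiable_continuous.
  by apply/derivable1_diffP; have [] := ff' x.
by move=> c _ ->; rewrite normrM ler_wpM2r.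
Qed.

End flat_functions.

(** * Mollification *)

Section lipschitz_continuity.
Local Close Scope ereal_scope.
Context {R : realType}.

Lemma lipschitz_bound_continuous (V W : normedModType R) (f : V -> W) (K : R) :
  0 <= K -> (forall x y, `|f x - f y| <= K * `|x - y|) -> continuous f.
Proof.
move=> K0 fK x; apply/cvgrPdist_le => e e0; near=> y.
apply: le_trans (fK _ _) _.
have h : `|x - y| <= e / (K + 1).
  near: y; apply: cvgr_dist_le; first exact: cvg_id.
  by rewrite divr_gt0// ltr_wpDl.
apply: (@le_trans _ _ (K * (e / (K + 1)))); first by rewrite ler_wpM2l.
by rewrite mulrCA ler_piMr ?(ltW e0)// ler_pdivrMr ?mul1r ?lerDl// ltr_wpDl.
Unshelve. all: by end_near. Qed.

Lemma continuous_measurable_rV n (f : 'rV[R]_n -> R) :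
  continuous f -> measurable_fun [set: 'rV[R]_n] f.
Proof.
move=> cf; apply: (measurability _ (RGenOpens.measurableE R)) => _ [_ [a [b ->]] <-].
rewrite setTI; apply: sub_sigma_algebra.
by apply: open_comp => [v _|]; [exact: cf|exact: interval_open].
Qed.

Lemma continuous_measurable_rV_rV n m (f : 'rV[R]_n -> 'rV[R]_m) :
  continuous f -> measurable_fun [set: 'rV[R]_n] f.
Proof.
move=> cf; apply: measurable_fun_rV => i; apply: continuous_measurable_rV => x.
apply: (@continuous_comp _ _ _ f (fun v => v ord0 i)); first exact: cf.
exact: coord_continuous.
Qed.

End lipschitz_continuity.

Section seminorm_invariance.
Local Close Scope ereal_scope.
Context {R : realType} {N : nat}.
Local Open Scope ereal_scope.
Implicit Types (s : R) (u : 'rV[R]_N -> R).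

Lemma Ws1_seminormZ s (c : R) u : measurable_fun [set: 'rV[R]_N] u ->
  Ws1_seminorm s (fun x => c * u x)%R = `|c|%:E * Ws1_seminorm s u.
Proof.
move=> mu; rewrite !Ws1_seminormE -ge0_integralZl//; last 2 first.
- exact: (measurable_fun_fubini_tonelli_F _ (measurable_Ws1_integrand s mu) (Ws1_integrand_ge0 s u)).
- by move=> x _; apply: integral_ge0 => y _; exact: (Ws1_integrand_ge0 s u (x, y)).
apply: eq_integral => x _; rewrite -ge0_integralZl//; last 2 first.
- exact: (measurable_fun_pair2 x (measurable_Ws1_integrand s mu)).
- by move=> y _; exact: (Ws1_integrand_ge0 s u (x, y)).
by apply: eq_integral => y _; rewrite /Ws1_integrand -mulrBr normrM -EFinM mulrA.
Qed.

Lemma Ws1_seminorm_translation s (a : 'rV[R]_N) u :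
  measurable_fun [set: 'rV[R]_N] u ->
  Ws1_seminorm s (fun x => u (x + a))%R = Ws1_seminorm s u.
Proof.
move=> mu; rewrite !Ws1_seminormE.
pose g := Ws1_integrand s u.
have mg : measurable_fun setT g by exact: measurable_Ws1_integrand.
have g0 p : 0 <= g p by exact: Ws1_integrand_ge0.
pose G x := \int[lebesgue_rV]_y g (x, y).
transitivity (\int[lebesgue_rV]_x G (x + a)%R); last first.
  have G0 x : 0 <= G x by exact: integral_ge0.
  have mG : measurable_fun setT G by exact: (measurable_fun_fubini_tonelli_F _ mg g0).
  exact: (@ge0_integral_translation R N a G mG G0).
apply: eq_integral => x _.
transitivity (\int[lebesgue_rV]_y g (x + a, y + a)%R).
  apply: eq_integral => y _; rewrite /g /Ws1_integrand /= /gagliardo_kernel.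
  by rewrite opprD addrACA subrr addr0.
have mgx : measurable_fun setT (fun y => g (x + a, y)%R).
  exact: (measurable_fun_pair2 _ mg).
exact: (@ge0_integral_translation R N a _ mgx (fun y => g0 _)).
Qed.

End seminorm_invariance.

Section product_kernels.
Local Close Scope ereal_scope.
Context {R : realType} {N : nat}.
Variable d : R.
Implicit Types (h : 'I_N -> R -> R) (x y z : 'rV[R]_N).

Definition product_kernel h x : R := \prod_i h i (x ord0 i).

Lemma product_kernel_lipschitz h : (forall i, flat_bump d (h i)) ->
  exists M K, [/\ 0 <= M, 0 <= K, forall x, `|product_kernel h x| <= M &
    forall x y, `|product_kernel h x - product_kernel h y| <= K * `|x - y|].
Proof.
move=> bh; rewrite /product_kernel; elim: (index_enum _) => [|i r [M [K [M0 K0 hM hK]]]].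
  exists 1, 0; split => // [x|x y]; rewrite !big_nil ?normr1//.
  by rewrite subrr normr0 mul0r.
have [B B1 hB] := flat_bump_bounded (bh i).
have [L L0 hL] := flat_bump_lipschitz (bh i).
have B0 : 0 <= B by apply: le_trans B1.
exists (B * M), (L * M + B * K); split => [|||x y].
- by rewrite mulr_ge0.
- by rewrite addr_ge0// mulr_ge0.
- by move=> x; rewrite big_cons normrM ler_pM.
rewrite !big_cons; set A := \prod_(j <- r) _; set A' := \prod_(j <- r) _.
rewrite (_ : _ - _ = (h i (x ord0 i) - h i (y ord0 i)) * A
  + h i (y ord0 i) * (A - A')); last by ring.
apply: le_trans (ler_normD _ _) _; rewrite !normrM mulrDl lerD//.
  rewrite (mulrAC L M) ler_pM//; last exact: hM.
  apply: le_trans (hL _ _) _; rewrite ler_wpM2l//.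
  by have := coord_le_norm (x - y) i; rewrite !mxE.
by rewrite -mulrA ler_pM//; exact: hK.
Qed.

Lemma measurable_product_kernel h : (forall i, flat_bump d (h i)) ->
  measurable_fun [set: 'rV[R]_N] (product_kernel h).
Proof.
move=> /product_kernel_lipschitz[M [K [_ K0 _ hK]]].
apply: continuous_measurable_rV.
exact: (@lipschitz_bound_continuous _ _ R^o _ _ K0 hK).
Qed.

Lemma product_kernel_out h x : (forall i, flat_bump d (h i)) -> 0 < d ->
  product_kernel h x != 0 -> `|x| < d.
Proof.
move=> bh d0; apply: contra_neqT; rewrite -leNgt => dx.
have xn0 : mx_norm x != 0.
  by rewrite gt_eqF//; apply: lt_le_trans dx.
have [[i j] /= xij] := mx_norm_neq0 xn0.
rewrite /product_kernel (bigD1 j)//= (flat_bump_out (bh j)) ?mul0r//.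
by rewrite (ord1 i) in xij; rewrite -xij.
Qed.

(** A partial derivative of a product kernel replaces one of its factors, hence
    is again a product kernel. *)
Definition set_factor h (i : 'I_N) (g : R -> R) : 'I_N -> R -> R :=
  fun j => if j == i then g else h j.

Lemma is_derive_product_kernel h (i : 'I_N) (g : R -> R) x y (t : R) :
  (forall t : R, is_derive t 1 (h i) (g t)) ->
  is_derive t 1 (fun t : R => product_kernel h (y - (t *: delta_mx ord0 i + x)))
    (product_kernel (set_factor h i (fun t => -1 * g t))
       (y - (t *: delta_mx ord0 i + x))).
Proof.
move=> hg; pose P := \prod_(j | j != i) h j (y ord0 j - x ord0 j).
pose c := y ord0 i - x ord0 i.
have E1 : (fun t : R => product_kernel h (y - (t *: delta_mx ord0 i + x))) =
    (fun t => P * h i (c - t)).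
  apply/funext => r; rewrite /product_kernel (bigD1 i)//= mulrC; congr (_ * _).
    apply: eq_bigr => j ji; rewrite !mxE (negbTE ji) andbF mulr0 add0r//.
  by rewrite !mxE !eqxx mulr1; congr (h i _); rewrite /c; ring.
have -> : product_kernel (set_factor h i (fun t => -1 * g t))
    (y - (t *: delta_mx ord0 i + x)) = P * (g (c - t) * -1).
  rewrite /product_kernel (bigD1 i)//= mulrC; congr (_ * _).
    apply: eq_bigr => j ji.
    by rewrite /set_factor (negbTE ji) !mxE (negbTE ji) andbF mulr0 add0r.
  rewrite /set_factor eqxx mulrC !mxE !eqxx mulr1.
  by congr (g _ * _); rewrite /c; ring.
rewrite E1; apply: is_deriveZ.
apply: (@is_derive1_comp R (h i) (fun t => c - t) t).
have H := is_deriveB (is_derive_cst c t 1) (is_derive_id t 1).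
by apply: is_derive_eq H _; rewrite sub0r.
Qed.

End product_kernels.

Section mollification.
Local Close Scope ereal_scope.
Context {R : realType} {N : nat}.
Variables (d : R) (E : set 'rV[R]_N).
Hypothesis mE : measurable E.
Hypothesis E_fin : (lebesgue_rV E < +oo)%E.
Implicit Types (h : 'I_N -> R -> R) (x y z : 'rV[R]_N).

(** The kernel is evaluated at [y - x], not [x - y], so that the translation
    [y = z + x] turns it into an average of translates even when the kernel is
    not symmetric. *)
Definition mollify h x : R :=
  \int[lebesgue_rV]_(y in E) product_kernel h (y - x).

Let int_cst (M : R) : lebesgue_rV.-integrable E (EFin \o (fun=> M)).
Proof.
apply/integrableP; split; first by apply/measurable_EFinP.
by rewrite (eq_integral (cst `|M|%:E))// integral_cst//= lte_mul_pinfty.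
Qed.

Let m_kernel h x : (forall i, flat_bump d (h i)) ->
  measurable_fun [set: 'rV[R]_N] (fun y => product_kernel h (y - x)).
Proof.
move=> bh; apply: (measurableT_comp (measurable_product_kernel bh)).
exact: measurable_fun_subr_rV.
Qed.

Let int_kernel h x : (forall i, flat_bump d (h i)) ->
  lebesgue_rV.-integrable E (EFin \o (fun y => product_kernel h (y - x))).
Proof.
move=> bh; have [M [K [M0 K0 hM hK]]] := product_kernel_lipschitz bh.
apply: le_integrable (int_cst M) => //.
  by apply/measurable_EFinP; apply: measurable_funS (m_kernel x bh).
by move=> y _; rewrite lee_fin/= (ger0_norm M0); exact: hM.
Qed.

Lemma mollify_continuous h : (forall i, flat_bump d (h i)) -> continuous (mollify h).
Proof.
move=> bh; have [M [K [M0 K0 hM hK]]] := product_kernel_lipschitz bh.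
apply: (@lipschitz_bound_continuous _ _ _ _ (K * fine (lebesgue_rV E))).
  by rewrite mulr_ge0// fine_ge0.
move=> x y.
have iB : lebesgue_rV.-integrable E
    (EFin \o (fun z => product_kernel h (z - x) - product_kernel h (z - y))).
  have -> : (EFin \o (fun z => product_kernel h (z - x) - product_kernel h (z - y)))
    = ((EFin \o (fun z => product_kernel h (z - x))) \-
       (EFin \o (fun z => product_kernel h (z - y))))%E by [].
  by apply: integrableB => //; exact: int_kernel.
rewrite /mollify -RintegralB//; try exact: int_kernel.
apply: le_trans (le_normr_Rintegral _ iB) _ => //.
rewrite mulrAC -Rintegral_cst//; apply: le_Rintegral => //; first exact: integrable_norm.
move=> z _ /=; apply: le_trans (hK _ _) _; rewrite ler_wpM2l//.
by rewrite opprB addrC addrA subrK distrC.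
Qed.

Lemma is_derive_mollify h (i : 'I_N) (g : R -> R) x : (forall i, flat_bump d (h i)) ->
  flat_bump d g -> (forall t : R, is_derive t 1 (h i) (g t)) ->
  is_derive x (delta_mx ord0 i) (mollify h : _ -> R^o)
    (mollify (set_factor h i (fun t => -1 * g t)) x).
Proof.
move=> bh bg hg.
have bh' j : flat_bump d (set_factor h i (fun t => -1 * g t) j).
  by rewrite /set_factor; case: eqP => // _; exact: flat_bump_scale.
have [M [K [M0 K0 hM hK]]] := product_kernel_lipschitz bh'.
pose f (t : R) y := product_kernel h (y - (t *: delta_mx ord0 i + x)).
have df (t : R) y : is_derive t 1 (f ^~ y)
    (product_kernel (set_factor h i (fun t => -1 * g t)) (y - (t *: delta_mx ord0 i + x))).
  exact: is_derive_product_kernel.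
have pf (t : R) y : partial1of2 f t y =
    product_kernel (set_factor h i (fun t => -1 * g t)) (y - (t *: delta_mx ord0 i + x)).
  by rewrite partial1of2E; have [_ ->] := df t y.
have I0 : (`]-1, 1[%classic : set R) 0 by rewrite /= in_itv/= ltrN10 ltr01.
have := @cvg_differentiation_under_integral R _ _ (@lebesgue_rV R N) f E mE 0 (-1) 1 I0
  (fun t _ => int_kernel _ bh) (fun t y _ _ => @ex_derive _ _ _ _ _ _ _ (df t y))
  (fun=> M) (fun=> M0) (int_cst M).
have Mb t y : (`]-1, 1[%classic : set R) t -> E y -> `|partial1of2 f t y| <= M.
  by move=> _ _; rewrite pf.
move=> /(_ Mb).
have -> : \int[lebesgue_rV]_(y in E) partial1of2 f 0 y =
    mollify (set_factor h i (fun t => -1 * g t)) x.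
  by apply: eq_Rintegral => y _; rewrite pf scale0r add0r.
have -> : (fun t : R => t^-1 *: (\int[lebesgue_rV]_(y in E) f (t + 0) y -
      \int[lebesgue_rV]_(y in E) f 0 y)) =
    (fun t : R => t^-1 *: (((mollify h : _ -> R^o) \o shift x) (t *: delta_mx ord0 i)
      - mollify h x)).
  by apply/funext => t; rewrite addr0 /f scale0r add0r.
move=> H; apply: DeriveDef; last exact: cvg_lim H.
by apply/cvg_ex; eexists; exact: H.
Qed.

(** The class of mollifications by product kernels is closed under partial
    derivatives, and its members are continuous. *)
Lemma mollify_class_C k h : (forall i, flat_bump d (h i)) -> class_C k (mollify h).
Proof.
elim: k h => [|k IH] h bh; first exact: mollify_continuous.
move=> i; have [g bg hg] := flat_bump_derive (bh i).
split => [x|]; first by have [] := is_derive_mollify x bh bg hg.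
have -> : (fun x => 'D_(delta_mx ord0 i) (mollify h : _ -> R^o) x) =
    mollify (set_factor h i (fun t => -1 * g t)).
  by apply/funext => x; have [_ ->] := is_derive_mollify x bh bg hg.
apply: IH => j; rewrite /set_factor; case: eqP => // _; exact: flat_bump_scale.
Qed.

Lemma mollify_support h x : (forall i, flat_bump d (h i)) -> 0 < d ->
  mollify h x != 0 -> exists2 y, E y & `|y - x| < d.
Proof.
move=> bh d0; apply: contra_neqP => H.
rewrite /mollify (_ : Rintegral _ _ _ = \int[lebesgue_rV]_(y in E) 0).
  by rewrite Rintegral_cst// mul0r.
apply: eq_Rintegral => y; rewrite inE => Ey.
apply/eqP; apply: contra_notT H => /(product_kernel_out bh d0) yx.
by exists y.
Qed.

End mollification.

Section jensen.
Context {R : realType} {N : nat}.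
Variables (s d : R) (E : set 'rV[R]_N).
Hypothesis mE : measurable E.
Hypothesis E_fin : lebesgue_rV E < +oo.
Hypothesis d0 : (0 < d)%R.
Implicit Types x y z : 'rV[R]_N.

Let h (i : 'I_N) (t : R) : R := (flat 0 (d + t) * flat 0 (d - t))%R.

Let bh i : flat_bump d (h i). Proof. exact: flat_bump_prod. Qed.

Let rho : 'rV[R]_N -> R := product_kernel h.

Let phi : 'rV[R]_N -> R := mollify E h.

Let rho_ge0 z : (0 <= rho z)%R.
Proof. by apply: prodr_ge0 => i _; rewrite mulr_ge0// flat_ge0. Qed.

Let m_rho : measurable_fun [set: 'rV[R]_N] rho.
Proof. exact: (measurable_product_kernel bh). Qed.

Let mass : \bar R := \int[lebesgue_rV]_z (rho z)%:E.

Let mass_fin : mass < +oo.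
Proof.
have [M [K [M0 _ hM _]]] := product_kernel_lipschitz bh.
pose B : set 'rV[R]_N := ball 0%R (Num.truncn d).+1%:R.
have mB : measurable B by apply: measurable_open_rV; exact: ball_open.
apply: (@le_lt_trans _ _ (\int[lebesgue_rV]_(z in B) M%:E)).
  rewrite [leRHS]integral_mkcond; apply: ge0_le_integral => //.
  - by move=> z _; rewrite lee_fin.
  - exact/measurable_EFinP.
  - by apply/(measurable_restrictT _ mB); exact: measurable_cst.
  move=> z _; rewrite patchE; case: ifPn => [_|].
    by rewrite lee_fin; apply: le_trans (ler_norm _) (hM z).
  rewrite notin_setE => zB; rewrite lee_fin le_eqVlt; apply/orP; left.
  apply: contra_notT zB => /(product_kernel_out bh d0) zd.
  rewrite /B mx_norm_ball /ball_/= sub0r normrN.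
  by apply: lt_trans zd _; exact: truncnS_gt.
by rewrite integral_cst// lte_mul_pinfty//; exact: lebesgue_ball_fin.
Qed.

Let mass_gt0 : 0 < mass.
Proof.
rewrite lt0e integral_ge0 ?andbT; last by move=> z _; rewrite lee_fin.
apply/eqP => m0.
have : \int[lebesgue_rV]_(z in setT) `|(rho z)%:E| = 0.
  by rewrite -m0; apply: eq_integral => z _; rewrite gee0_abs ?lee_fin.
move=> /ae_eq_integral_abs => /(_ measurableT).
move=> /(_ (proj2 (measurable_EFinP _ _) m_rho)) [A [mA A0 hA]].
pose I (i : 'I_N) : set (measurableTypeR R) := `](- d)%R, d%R[%classic.
have mI i : measurable (I i) by exact: measurable_itv.
suff : lebesgue_rV [set v : 'rV[R]_N | forall i, I i (v ord0 i)] <= 0.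
  rewrite lebesgue_rV_box// (eq_bigr (fun=> (d + d)%:E)).
    by rewrite prodEFin lee_fin leNgt prodr_gt0// => i _; rewrite addr_gt0.
  move=> i _; rewrite /I lebesgue_measure_itv/= lte_fin gtrN//.
  by rewrite -EFinB opprK.
rewrite -A0; apply: le_measure; rewrite ?inE//; first exact: measurable_box_rV.
move=> v vI; apply: hA => /= /(_ Logic.I).
have : (0 < rho v)%R.
  apply: prodr_gt0 => i _; have := vI i; rewrite /I/= in_itv/= => /andP[v1 v2].
  rewrite /h mulr_gt0// /flat expr0 mul1r ifT ?expR_gt0//; lra.
by move=> rv [rv0]; move: rv; rewrite rv0 ltxx.
Qed.

Let F z x : R := (rho z * \1_E (x + z))%R.

Let m_shift : measurable_fun [set: 'rV[R]_N * 'rV[R]_N]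
  (fun p => \1_E (p.2 + p.1)%R : R).
Proof.
apply: (measurableT_comp (measurable_indic mE)).
by apply: measurable_fun_addr_rV; [exact: measurable_snd|exact: measurable_fst].
Qed.

Let mF : measurable_fun [set: 'rV[R]_N * 'rV[R]_N] (fun p => F p.1 p.2).
Proof.
apply: measurable_funM => //.
exact: (measurableT_comp m_rho measurable_fst).
Qed.

Let F_ge0 z x : (0 <= F z x)%R.
Proof. by rewrite mulr_ge0. Qed.

Let phiE x : (phi x)%:E = \int[lebesgue_rV]_z (F z x)%:E.
Proof.
have [M [K [M0 K0 hM _]]] := product_kernel_lipschitz bh.
have mk : measurable_fun [set: 'rV[R]_N] (fun y => rho (y - x)%R).
  by apply: (measurableT_comp m_rho); exact: measurable_fun_subr_rV.
pose g y := (\1_E y * rho (y - x))%R%:E.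
have mg : measurable_fun setT g.
  by apply/measurable_EFinP; apply: measurable_funM.
have g0 y : 0 <= g y by rewrite lee_fin mulr_ge0.
have Eg : \int[lebesgue_rV]_(y in E) (rho (y - x)%R)%:E = \int[lebesgue_rV]_y g y.
  rewrite integral_mkcond; apply: eq_integral => y _; rewrite patchE /g indicE.
  by case: ifPn => _; rewrite ?mul1r ?mul0r.
rewrite /phi /mollify /Rintegral fineK; last first.
  rewrite ge0_fin_numE; last by apply: integral_ge0 => y _; rewrite lee_fin.
  apply: (@le_lt_trans _ _ (\int[lebesgue_rV]_(y in E) M%:E)).
    apply: ge0_le_integral => //.
    - by move=> y _; rewrite lee_fin.
    - by apply/measurable_EFinP; exact: measurable_funTS.
    - by move=> y _; rewrite lee_fin; apply: le_trans (ler_norm _) (hM _).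
  by rewrite integral_cst// lte_mul_pinfty.
rewrite -[LHS]/(\int[lebesgue_rV]_(y in E) (rho (y - x)%R)%:E) Eg.
transitivity (\int[lebesgue_rV]_z g (z + x)%R).
  by apply/esym; exact: (@ge0_integral_translation R N x g mg g0).
by apply: eq_integral => z _; rewrite /g /F addrK mulrC (addrC x).
Qed.

Let mollify_ge0 x : (0 <= phi x)%R.
Proof.
by rewrite -lee_fin phiE; apply: integral_ge0 => z _; rewrite lee_fin.
Qed.

Let m_phi : measurable_fun [set: 'rV[R]_N] phi.
Proof. by apply: continuous_measurable_rV; exact: (mollify_continuous mE E_fin bh). Qed.

Let integral_mollify : \int[lebesgue_rV]_x (phi x)%:E = mass * lebesgue_rV E.
Proof.
under eq_integral do rewrite phiE.
have mEF : measurable_fun [set: 'rV[R]_N * 'rV[R]_N] (fun p => (F p.1 p.2)%:E).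
  exact/measurable_EFinP.
have F0 (p : 'rV[R]_N * 'rV[R]_N) : 0 <= (F p.1 p.2)%:E by rewrite lee_fin.
rewrite -(fubini_tonelli _ mEF F0).
rewrite muleC -ge0_integralZl//; last 2 first.
- exact/measurable_EFinP.
- by move=> z _; rewrite lee_fin.
apply: eq_integral => z _; rewrite /F /=.
under eq_integral do rewrite EFinM.
have m1 : measurable_fun [set: 'rV[R]_N] (fun x => (\1_E x)%:E : \bar R).
  by apply/measurable_EFinP; exact: measurable_indic.
rewrite ge0_integralZl//; last 2 first.
- apply: (measurableT_comp m1 (g := fun x => x + z)%R).
  exact: measurable_fun_addr_rV.
- by rewrite lee_fin.
have -> : \int[lebesgue_rV]_x (\1_E (x + z)%R)%:E =
    \int[lebesgue_rV]_x (\1_E x)%:E :> \bar R.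
  have i0 (x : 'rV[R]_N) : 0 <= (\1_E x)%:E :> \bar R by rewrite lee_fin.
  exact: (@ge0_integral_translation R N z _ m1 i0).
by rewrite integral_indic// setIT muleC.
Qed.

Let int_F x : lebesgue_rV.-integrable setT (fun z => (F z x)%:E).
Proof.
apply/integrableP; split.
  by apply/measurable_EFinP; exact: (measurable_fun_pair1 x mF).
under eq_integral do rewrite gee0_abs ?lee_fin//.
by rewrite -phiE ltry.
Qed.

(* Minkowski's integral inequality: [phi] is an average of translates of
   [1_E], which all have the same seminorm *)
Let Ws1_seminorm_mollify_le : Ws1_seminorm s phi <= mass * s_perimeter s E.
Proof.
have m1 : measurable_fun [set: 'rV[R]_N] (\1_E : 'rV[R]_N -> R).
  exact: measurable_indic.
apply: (@le_trans _ _ (\int[lebesgue_rV]_z Ws1_seminorm s (F z))); last first.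
  rewrite muleC -ge0_integralZl//; last 3 first.
  - exact/measurable_EFinP.
  - by move=> z _; rewrite lee_fin.
  - exact: Ws1_seminorm_ge0.
  rewrite le_eqVlt; apply/orP; left; apply/eqP/eq_integral => z _.
  rewrite /F Ws1_seminormZ; last first.
    by apply: (measurableT_comp m1); exact: measurable_fun_addr_rV.
  by rewrite Ws1_seminorm_translation// ger0_norm// muleC.
rewrite (integral_Ws1_seminorm _ mF) Ws1_seminormE.
pose D (p : 'rV[R]_N * ('rV[R]_N * 'rV[R]_N)) := (`|F p.1 p.2.1 - F p.1 p.2.2|%R)%:E.
have mD : measurable_fun setT D.
  apply/measurable_EFinP; apply: measurableT_comp => //.
  apply: measurable_funB.
    apply: (measurableT_comp mF (g := fun p => (p.1, p.2.1))).
    apply: measurable_fun_pair; first exact: measurable_fst.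
    exact: (measurableT_comp measurable_fst measurable_snd).
  apply: (measurableT_comp mF (g := fun p => (p.1, p.2.2))).
  apply: measurable_fun_pair; first exact: measurable_fst.
  exact: (measurableT_comp measurable_snd measurable_snd).
have D0 p : 0 <= D p by rewrite lee_fin.
have mDk : measurable_fun [set: 'rV[R]_N * 'rV[R]_N] (fun p =>
    (\int[lebesgue_rV]_z D (z, p)) * (gagliardo_kernel s p.1 p.2)%:E).
  apply: emeasurable_funM.
    exact: (measurable_fun_fubini_tonelli_G _ mD D0).
  apply/measurable_EFinP; apply: measurable_gagliardo_kernel.
    exact: measurable_fst.
  exact: measurable_snd.
have Dk0 (p : 'rV[R]_N * 'rV[R]_N) :
    0 <= (\int[lebesgue_rV]_z D (z, p)) * (gagliardo_kernel s p.1 p.2)%:E.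
  by rewrite mule_ge0 ?integral_ge0// lee_fin gagliardo_kernel_ge0.
apply: (ge0_le_iterated_integral (measurable_Ws1_integrand s m_phi)
  (Ws1_integrand_ge0 s phi) mDk Dk0).
apply: aeW => x; apply: aeW => y.
rewrite /Ws1_integrand EFinM lee_wpmul2r ?lee_fin ?gagliardo_kernel_ge0//.
have iB : lebesgue_rV.-integrable setT (fun z => (F z x)%:E - (F z y)%:E).
  exact: integrableB.
have -> : (`|phi x - phi y|%R)%:E =
    `| \int[lebesgue_rV]_z ((F z x)%:E - (F z y)%:E) |.
  by rewrite (integralB measurableT (int_F x) (int_F y)) -!phiE.
have /integrableP[mB _] := iB.
exact: (le_abse_integral _ measurableT mB).
Qed.

(** Mollification multiplies the mass by [c], the mass of the kernel, and the
    seminorm by at most [c]; the Rayleigh quotient of [phi] is thus at most the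
    Cheeger ratio of [E], whatever the scale [d]. *)
Lemma exists_mollification : exists phi : 'rV[R]_N -> R, exists2 c : R, (0 < c)%R &
  [/\ smooth phi, forall x, (0 <= phi x)%R,
      forall x, phi x != 0%R -> exists2 y, E y & (`|y - x| < d)%R,
      \int[lebesgue_rV]_x (phi x)%:E = c%:E * lebesgue_rV E &
      Ws1_seminorm s phi <= c%:E * s_perimeter s E].
Proof.
have [c massE] : exists c : R, mass = c%:E.
  by exists (fine mass); rewrite fineK// ge0_fin_numE// ltW.
exists phi, c; first by rewrite -lte_fin -massE mass_gt0.
split.
- by move=> k; exact: (mollify_class_C mE E_fin).
- exact: mollify_ge0.
- by move=> x; exact: (mollify_support mE bh).
- by rewrite -massE; exact: integral_mollify.
- by rewrite -massE; exact: Ws1_seminorm_mollify_le.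
Qed.

End jensen.

(** * Near isometries *)

Section near_isometries.
Local Close Scope ereal_scope.
Context {R : realType} {N : nat}.
Implicit Types (L : R) (f : 'rV[R]_N -> 'rV[R]_N) (x y : 'rV[R]_N).

Lemma norm_le_enorm x : `|x| <= enorm x.
Proof.
apply/rV_norm_leP => [|i]; first exact: sqrtr_ge0.
rewrite -sqrtr_sqr ler_wsqrtr// (bigD1 i)//= lerDl sumr_ge0// => j _.
exact: sqr_ge0.
Qed.

Lemma enorm_le_norm x : enorm x <= N%:R * `|x|.
Proof.
have Nx0 : 0 <= N%:R * `|x| by rewrite mulr_ge0.
rewrite -[leRHS](ger0_norm Nx0) -sqrtr_sqr ler_wsqrtr//.
apply: (@le_trans _ _ (\sum_(i < N) `|x| ^+ 2)).
  apply: ler_sum => i _; rewrite -real_normK ?num_real//.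
  by rewrite lerXn2r ?nnegrE// coord_le_norm.
rewrite sumr_const card_ord -[leLHS]mulr_natl exprMn ler_wpM2r ?sqr_ge0//.
by rewrite -natrX ler_nat expnS expn1; case: (N) => // n; rewrite leq_pmulr.
Qed.

(** The sup norm controls volumes, the Euclidean norm controls the kernel of the
    seminorm: both have to be nearly preserved. *)
Definition near_isometry L f :=
  [/\ forall x y, `|f x - f y| <= L * `|x - y|,
      forall x y, `|x - y| <= L * `|f x - f y|,
      forall x y, enorm (f x - f y) <= L * enorm (x - y) &
      forall y, exists x, f x = y].

Lemma near_isometry_id : near_isometry 1 id.
Proof. by split => [x y|x y|x y|y]; rewrite ?mul1r//; exists y. Qed.

Lemma near_isometryS L L' f : L <= L' -> near_isometry L f -> near_isometry L' f.
Proof.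
move=> LL' [f1 f2 f3 f4]; split => // x y.
- by apply: le_trans (f1 x y) _; rewrite ler_wpM2r.
- by apply: le_trans (f2 x y) _; rewrite ler_wpM2r.
- by apply: le_trans (f3 x y) _; rewrite ler_wpM2r// sqrtr_ge0.
Qed.

Lemma near_isometry_comp L L' f g : 0 <= L -> 0 <= L' ->
  near_isometry L f -> near_isometry L' g -> near_isometry (L * L') (f \o g).
Proof.
move=> L0 L'0 [f1 f2 f3 f4] [g1 g2 g3 g4]; split => [x y|x y|x y|y] /=.
- by apply: le_trans (f1 _ _) _; rewrite -mulrA ler_wpM2l.
- by apply: le_trans (g2 _ _) _; rewrite (mulrC L) -mulrA ler_wpM2l.
- by apply: le_trans (f3 _ _) _; rewrite -mulrA ler_wpM2l.
- by have [z <-] := f4 y; have [x <-] := g4 z; exists x.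
Qed.

Section distortion.
Variables (L : R) (f : 'rV[R]_N -> 'rV[R]_N).
Hypothesis L1 : 1 <= L.
Hypothesis fL : near_isometry L f.

Let L0 : 0 <= L. Proof. exact: le_trans L1. Qed.

Lemma near_isometry_continuous : continuous f.
Proof. by have [f1 _ _ _] := fL; exact: lipschitz_bound_continuous f1. Qed.

Lemma measurable_near_isometry : measurable_fun [set: 'rV[R]_N] f.
Proof. exact: continuous_measurable_rV_rV near_isometry_continuous. Qed.

Lemma measurable_preimage_near_isometry E : measurable E -> measurable (f @^-1` E).
Proof.
by move=> mE; rewrite -[X in measurable X]setTI; exact: measurable_near_isometry.
Qed.

(** Apply the volume bound for expanding maps to a right inverse of [f]. *)
Lemma volume_near_isometry E : measurable E ->
  (lebesgue_rV E <= (L ^+ N)%:E * lebesgue_rV (f @^-1` E))%E.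
Proof.
move=> mE; have [f1 f2 _ f4] := fL; have [g fg] := choice f4.
have mg : measurable_fun [set: 'rV[R]_N] g.
  apply: continuous_measurable_rV_rV; apply: (lipschitz_bound_continuous L0) => x y.
  by have := f2 (g x) (g y); rewrite !fg.
have -> : E = g @^-1` (f @^-1` E) by apply/seteqP; split => x /=; rewrite fg.
have := @lebesgue_preimage_expanding _ _ L g mg _ L0 (f @^-1` E).
have -> : f @^-1` (g @^-1` (f @^-1` E)) = f @^-1` E.
  by apply/seteqP; split => x /=; rewrite fg.
apply => [x y|]; last exact: measurable_preimage_near_isometry.
by have := f1 (g x) (g y); rewrite !fg.
Qed.

Local Open Scope ereal_scope.

(** The kernel costs a factor [L `^ (N + s)], and each of the two integrations a
    factor [L ^+ N]. *)
Lemma perimeter_near_isometry (s : R) E : (0 < s)%R -> measurable E ->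
  s_perimeter s (f @^-1` E) <=
  (L `^ (N%:R + s) * L ^+ N * L ^+ N)%:E * s_perimeter s E.
Proof.
move=> s0 mE; have [f1 f2 f3 f4] := fL.
have LN0 : (0 <= L ^+ N)%R by exact: exprn_ge0.
have mE1 : measurable_fun [set: 'rV[R]_N] (\1_E : 'rV[R]_N -> R).
  exact: measurable_indic.
pose G := Ws1_integrand s \1_E.
have G0 p : 0 <= G p by exact: Ws1_integrand_ge0.
have mG : measurable_fun setT G by exact: measurable_Ws1_integrand.
pose I x : \bar R := \int[lebesgue_rV]_y G (x, y).
have I0 x : 0 <= I x by exact: integral_ge0.
have mI : measurable_fun setT I by exact: (measurable_fun_fubini_tonelli_F _ mG G0).
have mf := measurable_near_isometry.
have mLG : measurable_fun [set: 'rV[R]_N * 'rV[R]_N]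
    (fun p => (L `^ (N%:R + s))%:E * G (f p.1, f p.2)).
  apply: measurable_funeM.
  apply: (measurableT_comp mG (g := fun p => (f p.1, f p.2))).
  apply: measurable_fun_pair; [exact: (measurableT_comp mf measurable_fst)|
    exact: (measurableT_comp mf measurable_snd)].
have LG0 (p : 'rV[R]_N * 'rV[R]_N) : 0 <= (L `^ (N%:R + s))%:E * G (f p.1, f p.2).
  by rewrite mule_ge0// lee_fin powR_ge0.
have kernel_le x y : (gagliardo_kernel s x y <=
    L `^ (N%:R + s) * gagliardo_kernel s (f x) (f y))%R.
  have Ns0 : (0 < N%:R + s)%R by rewrite ltr_wpDl.
  rewrite /gagliardo_kernel.
  have e0 (z : 'rV[R]_N) : (0 <= enorm z)%R by exact: sqrtr_ge0.
  have [xy0|xy0] := eqVneq (enorm (x - y)) 0%R.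
    by rewrite xy0 powR0 ?gt_eqF// invr0 mulr_ge0// ?invr_ge0 powR_ge0.
  have fxy0 : (0 < enorm (f x - f y))%R.
    apply: (@lt_le_trans _ _ `|f x - f y|%R); last exact: norm_le_enorm.
    rewrite normr_gt0; apply: contra_neq xy0 => fxy.
    have := f2 x y; rewrite fxy normr0 mulr0 normr_le0 => /eqP ->.
    by rewrite /enorm big1 ?sqrtr0// => i _; rewrite mxE expr0n.
  rewrite ler_pdivlMr ?powR_gt0// mulrC ler_pdivrMr ?powR_gt0 ?lt0r ?xy0 ?e0//.
  rewrite -powRM//; apply: ge0_ler_powR; rewrite ?nnegrE ?mulr_ge0//.
  exact: ltW.
have ME1 : measurable_fun [set: 'rV[R]_N] (\1_(f @^-1` E) : 'rV[R]_N -> R).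
  by apply: measurable_indic; exact: measurable_preimage_near_isometry.
rewrite /s_perimeter Ws1_seminormE.
apply: (@le_trans _ _ (\int[lebesgue_rV]_x \int[lebesgue_rV]_y
    ((L `^ (N%:R + s))%:E * G (f x, f y)))).
  apply: (ge0_le_iterated_integral (measurable_Ws1_integrand s ME1)
    (Ws1_integrand_ge0 s _) mLG LG0).
  apply: aeW => x; apply: aeW => y.
  by rewrite /G /Ws1_integrand -EFinM lee_fin mulrCA ler_wpM2l.
apply: (@le_trans _ _ (\int[lebesgue_rV]_x
    ((L `^ (N%:R + s) * L ^+ N)%:E * I (f x)))).
  apply: ge0_le_integral => //.
  - by move=> x _; apply: integral_ge0 => y _; exact: (LG0 (x, y)).
  - exact: (measurable_fun_fubini_tonelli_F _ mLG LG0).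
  - by apply: measurable_funeM; exact: (measurableT_comp mI mf).
  move=> x _.
  have -> : \int[lebesgue_rV]_y ((L `^ (N%:R + s))%:E * G (f x, f y)) =
      (L `^ (N%:R + s))%:E * \int[lebesgue_rV]_y G (f x, f y).
    apply: (@ge0_integralZl _ _ _ (@lebesgue_rV R N) _ measurableT
      (fun y => G (f x, f y))).
    - apply: (measurableT_comp mG (g := fun y => (f x, f y))).
      by apply: measurable_fun_pair.
    - by move=> y _; exact: G0.
    - by rewrite lee_fin powR_ge0.
  rewrite EFinM -muleA; apply: lee_wpmul2l; first by rewrite lee_fin powR_ge0.
  have mGx : measurable_fun setT (fun z => G (f x, z)).
    exact: (measurable_fun_pair2 _ mG).
  exact: (@ge0_integral_expanding R N L f mf f2 L0 _ mGx (fun z => G0 _)).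
have -> : \int[lebesgue_rV]_x ((L `^ (N%:R + s) * L ^+ N)%:E * I (f x)) =
    (L `^ (N%:R + s) * L ^+ N)%:E * \int[lebesgue_rV]_x I (f x).
  apply: (@ge0_integralZl _ _ _ (@lebesgue_rV R N) _ measurableT (fun x => I (f x))).
  - exact: (measurableT_comp mI mf).
  - by move=> x _; exact: I0.
  - by rewrite lee_fin mulr_ge0// powR_ge0.
rewrite (EFinM (_ * _)) -muleA; apply: lee_wpmul2l.
  by rewrite lee_fin mulr_ge0 ?powR_ge0.
exact: (@ge0_integral_expanding R N L f mf f2 L0 I mI I0).
Qed.

End distortion.
End near_isometries.

(** * Pushing points across a Lipschitz boundary *)

Section local_push.
Local Close Scope ereal_scope.
Context {R : realType} {N : nat}.
Variables (x0 v : 'rV[R]_N) (rho L : R).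
Hypothesis rho0 : 0 < rho.
Hypothesis L1 : 1 < L.
Implicit Types x y : 'rV[R]_N.

Definition cone x : R := Num.max 0 (rho - `|x - x0|).

Lemma cone_ge0 x : 0 <= cone x. Proof. by rewrite /cone le_max lexx. Qed.

Lemma cone_le x : cone x <= rho.
Proof. by rewrite /cone ge_max (ltW rho0) gerBl normr_ge0. Qed.

Lemma cone_gt0 x : (0 < cone x) = (`|x - x0| < rho).
Proof. by rewrite /cone lt_max ltxx subr_gt0. Qed.

Lemma cone_lipschitz x y : `|cone x - cone y| <= `|x - y|.
Proof.
have H a b : cone a - cone b <= `|a - b|.
  rewrite lerBlDr /cone ge_max; apply/andP; split.
    by rewrite addr_ge0// le_max lexx.
  apply: (@le_trans _ _ (`|a - b| + (rho - `|b - x0|))).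
    have : `|b - x0| <= `|a - b| + `|a - x0|.
      by rewrite (distrC a b); exact: ler_distD.
    lra.
  by rewrite lerD2l le_max lexx orbT.
by rewrite ler_norml H andbT lerNl opprB distrC H.
Qed.

(** A Lipschitz constant of the displacement [push x - x] that is small enough to
    make [push] an [L]-near-isometry for both norms; the dimension enters through
    the comparison of the two norms. *)
Definition push_rate : R := (L - 1) / (L * (3 * N%:R + 1)).

Definition push_speed : R := push_rate / (`|v| + 1).

Definition push x : 'rV[R]_N := x + (push_speed * cone x) *: v.

Let L0 : 0 < L. Proof. exact: lt_trans L1. Qed.

Let N1 : 0 < 3 * N%:R + 1 :> R. Proof. by rewrite ltr_wpDl// mulr_ge0. Qed.

Let N1_ge1 : 1 <= 3 * N%:R + 1 :> R. Proof. by rewrite lerDr mulr_ge0. Qed.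

Lemma push_rate_gt0 : 0 < push_rate.
Proof. by rewrite divr_gt0 ?mulr_gt0// subr_gt0. Qed.

Lemma push_speed_gt0 : 0 < push_speed.
Proof. by rewrite divr_gt0 ?push_rate_gt0// ltr_wpDl. Qed.

Let speed_le : push_speed * `|v| <= push_rate.
Proof.
rewrite /push_speed mulrAC ler_pdivrMr ?ltr_wpDl// ler_wpM2l ?(ltW push_rate_gt0)//.
by rewrite lerDl.
Qed.

Let rateE : push_rate * L * (3 * N%:R + 1) = L - 1.
Proof.
rewrite /push_rate invfM; field.
by rewrite !gt_eqF.
Qed.

Let rate_le1 : push_rate <= 1.
Proof.
rewrite /push_rate ler_pdivrMr ?mulr_gt0// mul1r.
have : L <= L * (3 * N%:R + 1) by rewrite ler_pMr// N1_ge1.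
lra.
Qed.

Let rate_mul : push_rate * L <= L - 1.
Proof.
rewrite -rateE; apply: ler_peMr => //.
by rewrite mulr_ge0 ?(ltW push_rate_gt0) ?(ltW L0).
Qed.

Let rate_dim : 3 * N%:R * push_rate <= L - 1.
Proof.
have r0 := ltW push_rate_gt0.
have n0 : 0 <= N%:R :> R by [].
have -> : L - 1 = L * (3 * N%:R * push_rate) + push_rate * L by rewrite -rateE; ring.
rewrite -[leLHS]addr0; apply: lerD; last by rewrite mulr_ge0// ltW.
by apply: ler_peMl; [rewrite mulr_ge0// mulr_ge0|exact: ltW].
Qed.

Let rate_leB : push_rate <= L - 1.
Proof.
apply: le_trans rate_mul; apply: ler_peMr; last exact: ltW.
exact: ltW push_rate_gt0.
Qed.

Let displacement x y :
  `|(push_speed * cone x) *: v - (push_speed * cone y) *: v| <= push_rate * `|x - y|.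
Proof.
rewrite -scalerBl -mulrBr normrZ normrM (gtr0_norm push_speed_gt0) mulrAC.
by rewrite ler_pM// ?cone_lipschitz// mulr_ge0 ?(ltW push_speed_gt0).
Qed.

Let pushB x y : push x - push y = (x - y) +
  ((push_speed * cone x) *: v - (push_speed * cone y) *: v).
Proof. by rewrite /push opprD addrACA. Qed.

(* intermediate value theorem on the line through [y] directed by [v] *)
Let push_surj y : exists x, push x = y.
Proof.
pose phi (t : R) := t - push_speed * cone (y - t *: v).
have cphi : continuous phi.
  apply: (@lipschitz_bound_continuous R R^o R^o phi (1 + push_speed * `|v|)).
    by rewrite addr_ge0// mulr_ge0// ltW// push_speed_gt0.
  move=> a b; rewrite /phi opprD opprK addrACA mulrDl mul1r.
  apply: le_trans (ler_normD _ _) _; rewrite lerD//.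
  rewrite addrC -mulrBr normrM (gtr0_norm push_speed_gt0) -mulrA.
  rewrite ler_pM2l ?push_speed_gt0//; apply: le_trans (cone_lipschitz _ _) _.
  by rewrite opprB addrC addrA subrK -scalerBl normrZ mulrC.
have b0 : 0 <= push_speed * rho by rewrite mulr_ge0 ?ltW ?push_speed_gt0.
have [||t _ t0] := @IVT R phi 0 (push_speed * rho) 0 b0.
- exact: continuous_subspaceT.
- have p0 : phi 0 <= 0.
    by rewrite /phi sub0r oppr_le0 mulr_ge0 ?cone_ge0// ltW ?push_speed_gt0.
  have p1 : 0 <= phi (push_speed * rho).
    by rewrite /phi subr_ge0 ler_wpM2l ?cone_le// ltW ?push_speed_gt0.
  by rewrite ge_min le_max p0 p1 orbT.
exists (y - t *: v); rewrite /push.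
move/eqP: t0; rewrite subr_eq0 => /eqP <-.
by rewrite subrK.
Qed.

Lemma push_near_isometry : near_isometry L push.
Proof.
have r0 := ltW push_rate_gt0.
split => [x y|x y|x y|]; last exact: push_surj; rewrite ?pushB.
- apply: le_trans (ler_normD _ _) _.
  apply: (@le_trans _ _ (`|x - y| + push_rate * `|x - y|)).
    by rewrite lerD2l displacement.
  rewrite -[X in X + _]mul1r -mulrDl ler_wpM2r//.
  by have := rate_leB; lra.
- set b := _ - _ *: v; have := displacement x y; rewrite -/b => bd.
  have h : (1 - push_rate) * `|x - y| <= `|(x - y) + b|.
    have : `|x - y| <= `|(x - y) + b| + `|b|.
      by rewrite -[X in `|X| <= _](addrK b (x - y)); exact: ler_normB.
    rewrite mulrBl mul1r; lra.
  apply: le_trans (ler_wpM2l (ltW L0) h).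
  rewrite mulrA -[leLHS]mul1r ler_wpM2r//.
  by have := rate_mul; lra.
- set b := _ - _ *: v; have := displacement x y; rewrite -/b => bd.
  set a := x - y in bd *; set A := `|a| in bd *.
  have A0 : 0 <= A by exact: normr_ge0.
  rewrite -[leRHS](@ger0_norm _ (L * enorm a)); last first.
    by rewrite mulr_ge0 ?sqrtr_ge0// ltW.
  rewrite -sqrtr_sqr ler_wsqrtr//.
  have S0 : 0 <= \sum_(i < N) a ord0 i ^+ 2 by rewrite sumr_ge0// => i _; exact: sqr_ge0.
  rewrite exprMn /enorm sqr_sqrtr//.
  have A2 : A ^+ 2 <= \sum_(i < N) a ord0 i ^+ 2.
    rewrite -[leRHS]sqr_sqrtr// lerXn2r ?nnegrE ?sqrtr_ge0 ?normr_ge0//.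
    exact: (norm_le_enorm a).
  apply: (@le_trans _ _ (\sum_(i < N) (a ord0 i ^+ 2 + 3 * push_rate * A ^+ 2))).
    apply: ler_sum => i _; rewrite mxE sqrrD.
    have ai : `|a ord0 i| <= A by exact: coord_le_norm.
    have bi : `|b ord0 i| <= push_rate * A.
      by apply: le_trans (coord_le_norm _ _) bd.
    have ab : a ord0 i * b ord0 i <= push_rate * A ^+ 2.
      apply: le_trans (ler_norm _) _; rewrite normrM expr2 mulrCA.
      by rewrite ler_pM.
    have bb : b ord0 i ^+ 2 <= push_rate * A ^+ 2.
      rewrite -real_normK ?num_real//; apply: (@le_trans _ _ ((push_rate * A) ^+ 2)).
        apply: lerXn2r => //; rewrite nnegrE//; exact: mulr_ge0.
      by rewrite exprMn ler_wpM2r ?sqr_ge0// expr2 ler_piMl.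
    rewrite mulr2n; lra.
  rewrite big_split/= sumr_const card_ord.
  apply: (@le_trans _ _ ((1 + 3 * N%:R * push_rate) * \sum_(i < N) a ord0 i ^+ 2)).
    rewrite [leRHS]mulrDl mul1r lerD2l -[leLHS]mulr_natl.
    rewrite (_ : N%:R * _ = 3 * N%:R * push_rate * A ^+ 2); last by ring.
    by rewrite ler_wpM2l// mulr_ge0// mulr_ge0.
  rewrite ler_wpM2r//; have := rate_dim.
  have : L <= L ^+ 2 by rewrite expr2 ler_pMl// ltW.
  lra.
Qed.

Lemma push_fixed x : rho <= `|x - x0| -> push x = x.
Proof.
move=> xr; rewrite /push (_ : cone x = 0) ?mulr0 ?scale0r ?addr0//.
by apply/eqP; rewrite eq_le cone_ge0 andbT leNgt cone_gt0 -leNgt.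
Qed.

Lemma push_displacement x : `|push x - x| <= rho.
Proof.
rewrite /push addrAC subrr add0r normrZ ger0_norm; last first.
  by rewrite mulr_ge0 ?cone_ge0// ltW ?push_speed_gt0.
rewrite mulrAC -[leRHS]mul1r; apply: ler_pM; rewrite ?cone_ge0 ?cone_le//.
  by rewrite mulr_ge0// ltW ?push_speed_gt0.
by apply: le_trans rate_le1.
Qed.

End local_push.

Section retractions.
Local Close Scope ereal_scope.
Context {R : realType} {N : nat}.
Variable Omega : set 'rV[R]_N.
Implicit Types (L : R) (f : 'rV[R]_N -> 'rV[R]_N) (x y : 'rV[R]_N).

(** Points outside [Omega] either stay where they are or land in the exterior:
    the property passes to compositions, and gains made by one map are kept by
    the others. *)
Definition pushes_outward f := forall x, ~ Omega x -> f x = x \/ (~` Omega)° (f x).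

(** The deformations outward on [A] exist at every precision [L]: composing two of
    them then costs nothing, each being taken at precision [sqrt L]. *)
Definition pushable (A : set 'rV[R]_N) := forall L, 1 < L -> exists f,
  [/\ near_isometry L f, pushes_outward f &
      forall x, A x -> ~ Omega x -> (~` Omega)° (f x)].

Lemma pushable0 : pushable set0.
Proof.
move=> L L1; exists id; split => //; last by move=> x _; left.
exact: near_isometryS (ltW L1) near_isometry_id.
Qed.

Lemma pushableU A B : pushable A -> pushable B -> pushable (A `|` B).
Proof.
move=> pA pB L L1; pose K := Num.sqrt L.
have L0 : 0 < L by apply: lt_trans L1.
have K1 : 1 < K by rewrite /K -sqrtr1 ltr_sqrt.
have [f [fK fo fA]] := pA K K1; have [g [gK go gB]] := pB K K1.
have out x : (~` Omega)° x -> ~ Omega x by move=> /interior_subset.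
have keep h x : pushes_outward h -> (~` Omega)° x -> (~` Omega)° (h x).
  by move=> ho xo; have [->|] := ho x (out x xo).
exists (f \o g); split => [|x Ox|x ABx Ox] /=.
- rewrite (_ : L = K * K); last by rewrite -expr2 sqr_sqrtr// ltW.
  have K0 : 0 <= K by exact: sqrtr_ge0.
  exact: near_isometry_comp.
- by have [->|gx] := go x Ox; [exact: fo|right; exact: keep].
- case: ABx => [Ax|Bx]; last by apply: keep => //; exact: gB.
  by have [->|gx] := go x Ox; [exact: fA|exact: keep].
Qed.

Lemma pushableW A B : A `<=` B -> pushable B -> pushable A.
Proof.
move=> AB pB L L1; have [f [fL fo fB]] := pB L L1.
by exists f; split => // x /AB; exact: fB.
Qed.

Lemma pushable_compact A : compact A ->
  (forall x, A x -> exists2 r, 0 < r & pushable (ball x r)) -> pushable A.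
Proof.
move=> cA locA.
have /choice[r hr] : forall x, exists r, A x -> 0 < r /\ pushable (ball x r).
  move=> x; have [Ax|nAx] := pselect (A x); last by exists 0.
  by have [r r0 pr] := locA x Ax; exists r.
move: cA; rewrite compact_cover => /(_ _ A (fun x => ball x (r x))) [].
- by move=> x Ax; exact: ball_open.
- by move=> x Ax; exists x => //; apply: ballxx; have [] := hr x Ax.
move=> D DA AD; apply: pushableW AD _.
have : forall x, x \in enum_fset D -> A x by move=> x xD; have /set_mem := DA x xD.
have -> : cover [set` D] (fun x => ball x (r x)) =
    cover [set` enum_fset D] (fun x => ball x (r x)) by [].
rewrite /cover; elim: (enum_fset D) => [|x l IH] lA.
  by rewrite set_nil bigcup_set0; exact: pushable0.
apply: (@pushableW _ (ball x (r x) `|` \bigcup_(i in [set` l]) ball i (r i))).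
  by move=> y [i /=]; rewrite in_cons => /predU1P[->|il iy]; [left|right; exists i].
apply: pushableU.
  by have [] := hr x (lA x (mem_head _ _)).
by apply: IH => y yl; apply: lA; rewrite in_cons yl orbT.
Qed.

End retractions.

Section lipschitz_domains.
Local Close Scope ereal_scope.
Context {R : realType} {N : nat}.
Variable Omega : set 'rV[R]_N.
Implicit Types (x y z w : 'rV[R]_N).

Lemma lipschitz_exists_bound n (g : 'rV[R]_n -> R) : lipschitz (g : _ -> R^o) ->
  exists2 K, 0 <= K & forall a b, `|g a - g b| <= K * `|a - b|.
Proof.
move=> /pinfty_ex_gt0[K K0 gK]; exists K; first exact: ltW.
by move=> a b; exact: (gK (a, b)).
Qed.

Lemma mulmxr_norm_bound n (Q : 'M[R]_(N, n)) :
  exists2 C, 0 <= C & forall w, `|w *m Q| <= C * `|w|.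
Proof.
exists (\sum_j \sum_k `|Q j k|).
  by rewrite sumr_ge0// => j _; rewrite sumr_ge0.
move=> w; apply/rV_norm_leP => [|k].
  by rewrite mulr_ge0// sumr_ge0// => j _; rewrite sumr_ge0.
rewrite mxE; apply: le_trans (ler_norm_sum _ _ _) _; rewrite mulr_suml.
apply: ler_sum => j _; rewrite normrM mulrC ler_pM ?coord_le_norm//.
by rewrite (bigD1 k)//= lerDl sumr_ge0.
Qed.

Lemma col'_norm (i : 'I_N) w : `|col' i w| <= `|w|.
Proof.
by apply/rV_norm_leP => // j; rewrite mxE coord_le_norm.
Qed.

Lemma sub_bounded_set (A B : set 'rV[R]_N) : A `<=` B -> bounded_set B ->
  bounded_set A.
Proof.
move=> AB [M [Mr BM]]; exists M; split => // K MK x Ax.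
by apply: (BM _ MK); exact: AB.
Qed.

Lemma bounded_closure (A : set 'rV[R]_N) : bounded_set A ->
  bounded_set (closure A).
Proof.
move=> [M [Mr AM]]; exists (M + 2); split => [|K MK x cAx]; first exact: num_real.
have [y [Ay]] := cAx _ (@nbhsx_ballx _ _ x 1 ltr01).
rewrite mx_norm_ball /ball_/= => xy.
have yM : `|y| <= M + 1 by apply: AM => //; rewrite ltrDl.
have : `|x| <= `|y| + `|x - y| by rewrite addrC -[X in `|X| <= _](subrK y x) ler_normD.
move: MK xy yM; lra.
Qed.

Section graph_patch.
Variables (x0 : 'rV[R]_N) (r : R) (Q : 'M[R]_N) (i : 'I_N) (g : 'rV[R]_N.-1 -> R).
Hypothesis r0 : 0 < r.
Hypothesis QQ : Q *m Q^T = 1%:M.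
Hypothesis lipg : lipschitz (g : _ -> R^o).
Hypothesis patch : forall x, enorm (x - x0) < r ->
  Omega x <-> g (col' i (x *m Q)) < (x *m Q) ord0 i.

Let G z : R := g (col' i (z *m Q)) - (z *m Q) ord0 i.

Let continuous_G : continuous G.
Proof.
have [K K0 gK] := lipschitz_exists_bound lipg.
have [C C0 QC] := mulmxr_norm_bound Q.
apply: (@lipschitz_bound_continuous R _ R^o G (K * C + C)).
  by rewrite addr_ge0// mulr_ge0.
move=> x y; rewrite /G opprD addrACA mulrDl.
have xyQ : `|x *m Q - y *m Q| <= C * `|x - y| by rewrite -mulmxBl.
apply: le_trans (ler_normD _ _) _; apply: lerD.
  apply: le_trans (gK _ _) _; rewrite -mulrA ler_wpM2l//.
  apply: le_trans xyQ; apply: le_trans (col'_norm i _).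
  by rewrite linearB.
apply: le_trans xyQ; rewrite -opprD normrN.
by have := coord_le_norm (x *m Q - y *m Q) i; rewrite !mxE.
Qed.

(* the direction that decreases the graph coordinate *)
Let v : 'rV[R]_N := - (delta_mx ord0 i *m Q^T).

(* small enough for the sup-norm ball of radius [2 * rho] to lie in the
   Euclidean ball of radius [r], where the graph description is valid *)
Let rho : R := r / (2 * N%:R + 1).

Let N0 : 0 < 2 * N%:R + 1 :> R. Proof. by rewrite ltr_wpDl// mulr_ge0. Qed.

Let rho0 : 0 < rho. Proof. by rewrite divr_gt0. Qed.

Let patch_ball z : `|z - x0| < 2 * rho -> enorm (z - x0) < r.
Proof.
move=> zx; apply: le_lt_trans (enorm_le_norm _) _.
apply: (@le_lt_trans _ _ (N%:R * (2 * rho))); first by rewrite ler_wpM2l// ltW.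
have -> : N%:R * (2 * rho) = r - rho.
  by rewrite /rho; field; rewrite gt_eqF.
by rewrite gtrBl.
Qed.

Let vQ : v *m Q = - delta_mx ord0 i.
Proof. by rewrite /v mulNmx -mulmxA (mulmx1C QQ) mulmx1. Qed.

Let G_shift x (t : R) : G (x + t *: v) = G x + t.
Proof.
rewrite /G mulmxDl -scalemxAl vQ.
have -> : col' i (x *m Q + t *: - delta_mx ord0 i) = col' i (x *m Q).
  apply/rowP => j; rewrite !mxE eqxx/= eq_sym (negbTE (neq_lift _ _)).
  by rewrite oppr0 mulr0 addr0.
by rewrite !mxE !eqxx/=; ring.
Qed.

(** A push in the direction [v] lowers the graph coordinate and keeps the others:
    a point on or below the graph, if it moves, ends strictly below it. *)
Lemma pushable_patch : pushable Omega (ball x0 rho).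
Proof.
move=> L L1; exists (push x0 v rho L).
have inward x : `|x - x0| < rho -> ~ Omega x -> (~` Omega)° (push x0 v rho L x).
  move=> xr Ox; set z := push x0 v rho L x.
  have Gx : 0 <= G x.
    rewrite /G subr_ge0 leNgt; apply/negP => /(proj2 (patch _)); apply: contra_not Ox.
    apply; apply: patch_ball; apply: lt_trans xr _.
    by rewrite ltr_pMl// ltr1n.
  have Gz : 0 < G z.
    rewrite /z /push G_shift ltr_wpDl// mulr_gt0 ?push_speed_gt0//.
    by rewrite cone_gt0.
  have zx0 : `|z - x0| < 2 * rho.
    apply: le_lt_trans (ler_distD x _ _) _; rewrite mulr2n mulrDl mul1r.
    by apply: ler_ltD => //; exact: push_displacement.
  have oS : open ((G @^-1` [set t | 0 < t]) `&` ball x0 (2 * rho)).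
    apply: openI; last exact: ball_open.
    by apply: open_comp => [y _|]; [exact: continuous_G|exact: open_gt].
  apply: (@interiorS _ ((G @^-1` [set t | 0 < t]) `&` ball x0 (2 * rho))).
    move=> y [/= Gy]; rewrite mx_norm_ball /ball_/= distrC => /patch_ball yr Oy.
    have /(_ Oy) := proj1 (patch yr).
    by move: Gy; rewrite /G subr_gt0 => /lt_trans /[apply]; rewrite ltxx.
  rewrite (interior_id _).1//; split => //.
  by rewrite mx_norm_ball /ball_/= distrC.
split.
- exact: push_near_isometry.
- move=> x Ox; have [xr|xr] := leP rho `|x - x0|; last by right; exact: inward.
  by left; exact: push_fixed.
- move=> x; rewrite mx_norm_ball /ball_/= distrC; exact: inward.
Qed.

End graph_patch.

(** The preimage of [Omega] under [f] then stays away from the boundary. *)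
Lemma inward_deformation (L : R) : open Omega -> bounded_set Omega ->
  lipschitz_boundary Omega -> 1 < L ->
  exists f, near_isometry L f /\ forall x, ~ Omega x -> (~` Omega)° (f x).
Proof.
move=> oO bO lipO L1; pose B := closure Omega `\` Omega.
have pB : pushable Omega B.
  apply: pushable_compact.
    apply: bounded_closed_compact.
      by apply: sub_bounded_set (bounded_closure bO) => x [].
    rewrite /B setDE; apply: closedI; first exact: closed_closure.
    exact: open_closedC.
  move=> x [cx Ox].
  have [|r [Q [i [g [r0 QQ lipg patch]]]]] := lipO x cx.
    by rewrite (interior_id _).1.
  exists (r / (2 * N%:R + 1)); last exact: (pushable_patch r0 QQ lipg patch).
  by rewrite divr_gt0// ltr_wpDl// mulr_ge0.
have [f [fL fo fB]] := pB L L1; exists f; split => // x Ox.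
have [cx|cx] := pselect (closure Omega x); first exact: fB.
have xo : (~` Omega)° x by rewrite interiorC.
by have [->|] := fo x Ox.
Qed.

End lipschitz_domains.

(** * Smooth competitors and the first eigenvalue *)

Section smooth_competitors.
Context {R : realType} {N : nat}.
Variable Omega : set 'rV[R]_N.
Hypothesis oOmega : open Omega.
Hypothesis bOmega : bounded_set Omega.
Implicit Types (s : R) (E : set 'rV[R]_N) (f : 'rV[R]_N -> R).

Lemma class_CZ k (c : R) f : class_C k f -> class_C k (fun x => c * f x)%R.
Proof.
elim: k f => [|k IH] f /=.
  move=> cf x; apply: (@continuous_comp _ _ _ f (fun r : R => (c * r)%R)) (cf x) _.
  exact: mulrl_continuous.
move=> fC i; have [df Df] := fC i; split => [x|].
  exact: (@derivableZ _ _ R^o f c x _ (df x)).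
have -> : (fun x => 'D_(delta_mx ord0 i) ((fun x => c * f x)%R : _ -> R^o) x) =
    (fun x => c * 'D_(delta_mx ord0 i) (f : _ -> R^o) x)%R.
  by apply/funext => x; exact: (@deriveZ _ _ R^o f c x _ (df x)).
exact: IH.
Qed.

Lemma compact_margin (K : set 'rV[R]_N) : compact K -> K `<=` Omega ->
  exists2 e : R, (0 < e)%R & forall x y, K x -> (`|x - y| < e)%R -> Omega y.
Proof.
move=> /compact_near_coveringP cK KO.
have [|e /= e0 He] := cK R (0%R^'+) (fun e x => forall y, (`|x - y| < e)%R -> Omega y) _ _.
  move=> x Kx; have /nbhs_ballP[r /= r0 xrO] : nbhs x Omega.
    by apply: open_nbhs_nbhs; split => //; exact: KO.
  exists (ball x (r / 2), [set e | (e < r / 2)%R]).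
    split => /=; first by apply: nbhsx_ballx; rewrite divr_gt0.
    by apply: nbhs_right_lt; rewrite divr_gt0.
  move=> [x' e] /= [xx' er] y x'y; apply: xrO; rewrite mx_norm_ball /ball_/=.
  move: xx'; rewrite mx_norm_ball /ball_/= => xx'.
  by apply: le_lt_trans (ler_distD x' _ _) _; move: xx' x'y er; lra.
exists (e / 2)%R; first by rewrite divr_gt0.
move=> x y Kx; apply: (He (e / 2)%R) => //=; last by rewrite divr_gt0.
by rewrite sub0r normrN gtr0_norm ?divr_gt0// ltr_pdivrMr// ltr_pMr// ltr1n.
Qed.

Lemma Ws1_seminorm0 s : Ws1_seminorm s (fun _ : 'rV[R]_N => 0%R) = 0.
Proof.
apply: integral0_eq => x _; apply: integral0_eq => y _.
by rewrite subrr normr0 mul0r.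
Qed.

(** A test function approximates itself. *)
Lemma test_function_tildeW s f : test_function Omega f ->
  L1norm Omega f < +oo -> tildeW s Omega f.
Proof.
move=> tf Lf; have [sf cf fO] := tf.
have mf : measurable_fun [set: 'rV[R]_N] f.
  exact: continuous_measurable_rV (sf 0%N).
split.
  split => //.
    apply/integrableP; split => //.
    by apply/measurable_EFinP; exact: measurable_funTS.
  apply: aeW => x Ox; apply/eqP; apply: contra_notT Ox => fx.
  by apply: fO; exact: subset_closure.
move=> e e0; exists f => //.
have -> : (f \- f)%R = (fun=> 0%R) by apply/funext => x /=; rewrite subrr.
rewrite Ws1_seminorm0 add0e /L1norm integral0_eq ?lte_fin// => x _.
by rewrite normr0.
Qed.

(** The competitor is the mollification of [1_E], divided by its mass. *)
Lemma lambda11_le_compactly_contained s E : measurable E ->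
  closure E `<=` Omega -> 0 < lebesgue_rV E ->
  lambda11 s Omega <= cheeger_ratio s E.
Proof.
move=> mE cEO E0.
have EO : E `<=` Omega by apply: subset_trans cEO; exact: subset_closure.
have Efin : lebesgue_rV E < +oo.
  apply: lebesgue_bounded_fin => //; exact: sub_bounded_set bOmega.
have [||e e0 eO] := @compact_margin (closure E).
- apply: bounded_closed_compact; last exact: closed_closure.
  exact: sub_bounded_set cEO bOmega.
- exact: cEO.
have d0 : (0 < e / 2)%R by rewrite divr_gt0.
have [phi [c c0 [sphi phi0 phiE Iphi Wphi]]] := exists_mollification s mE Efin d0.
have [m m0 Em] : exists2 m, (0 < m)%R & lebesgue_rV E = m%:E.
  by move: E0 Efin; case: (lebesgue_rV E) => // m; rewrite lte_fin; exists m.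
have M0 : (0 < (c * m)^-1)%R by rewrite invr_gt0 mulr_gt0.
pose psi x : R := ((c * m)^-1 * phi x)%R.
have psi0 x : (0 <= psi x)%R by rewrite mulr_ge0// ltW.
have psiE x : psi x != 0%R -> exists2 y, E y & (`|y - x| < e / 2)%R.
  by rewrite mulf_eq0 negb_or => /andP[_ /phiE].
have spsi : closure [set x | psi x != 0%R] `<=` Omega.
  move=> x cx; have [z [/= /psiE[y Ey yz]]] := cx _ (nbhsx_ballx x _ d0).
  rewrite mx_norm_ball /ball_/= => xz.
  apply: (eO y x); first exact: subset_closure.
  by apply: le_lt_trans (ler_distD z _ _) _; move: yz xz; rewrite (distrC x); lra.
have tpsi : test_function Omega psi.
  split => //; first by move=> k; apply: class_CZ; exact: sphi.
  apply: bounded_closed_compact; last exact: closed_closure.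
  exact: sub_bounded_set spsi bOmega.
have mphi : measurable_fun [set: 'rV[R]_N] phi.
  exact: continuous_measurable_rV (sphi 0%N).
have L1 : L1norm Omega psi = 1.
  transitivity (\int[lebesgue_rV]_x (psi x)%:E).
    rewrite /L1norm integral_mkcond; apply: eq_integral => x _.
    rewrite patchE; case: ifPn => [_|]; first by rewrite ger0_norm.
    rewrite notin_setE => Ox; congr EFin; apply/esym/eqP.
    by apply: contra_notT Ox => px; apply: spsi; exact: subset_closure.
  rewrite /psi; under eq_integral do rewrite EFinM.
  rewrite ge0_integralZl//; last 3 first.
  - exact/measurable_EFinP.
  - by move=> x _; rewrite lee_fin.
  - by rewrite lee_fin ltW.
  by rewrite Iphi Em -!EFinM mulVf// gt_eqF// mulr_gt0.
apply: le_trans (ereal_inf_lbound _) _.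
  exists psi => //; split => //; last exact: aeW.
  by apply: test_function_tildeW => //; rewrite L1 ltry.
rewrite /psi Ws1_seminormZ// gtr0_norm//.
apply: le_trans (lee_wpmul2l _ Wphi) _; first by rewrite lee_fin ltW.
rewrite /cheeger_ratio Em EFin_inv// muleA -EFinM muleC invfM mulrAC mulVf ?mul1r//.
by rewrite gt_eqF.
Qed.

(** Replace [E] by its preimage under an inward deformation, which is compactly
    contained in [Omega] and whose Cheeger ratio is larger by a factor at most
    [L `^ (N + s) * L ^+ (3 * N)]; then let [L] tend to 1. *)
Lemma lambda11_le_ratio s E : (0 < s)%R -> lipschitz_boundary Omega ->
  cheeger_admissible Omega E -> lambda11 s Omega <= cheeger_ratio s E.
Proof.
move=> s0 lipO [mE EO E0].
have Efin : lebesgue_rV E < +oo.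
  apply: lebesgue_bounded_fin => //; exact: sub_bounded_set bOmega.
have [m m0 Em] : exists2 m, (0 < m)%R & lebesgue_rV E = m%:E.
  by move: E0 Efin; case: (lebesgue_rV E) => // m; rewrite lte_fin; exists m.
have [PE|PE] := eqVneq (s_perimeter s E) +oo.
  by rewrite /cheeger_ratio PE Em EFin_inv// gt0_mulye ?leey// lte_fin invr_gt0.
have [P P0 EP] : exists2 P, (0 <= P)%R & s_perimeter s E = P%:E.
  move: PE (Ws1_seminorm_ge0 s \1_E); rewrite -/(s_perimeter s E).
  by case: (s_perimeter s E) => // P _; rewrite lee_fin; exists P.
have ratioE : cheeger_ratio s E = (P / m)%:E.
  by rewrite /cheeger_ratio EP Em EFin_inv.
have q0 : (0 <= P / m)%R by rewrite divr_ge0// ltW.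
rewrite ratioE; apply/lee_addgt0Pr => e e0.
(* [L] is chosen to make the total distortion [L `^ p] equal to [1 + eta] *)
pose p : R := (N%:R + s + N%:R + N%:R + N%:R)%R.
have p0 : (0 < p)%R by rewrite /p; have : (0 <= N%:R :> R)%R by []; lra.
pose eta : R := (e / (P / m + 1))%R.
have eta0 : (0 < eta)%R by rewrite divr_gt0// ltr_wpDl.
pose L : R := ((1 + eta) `^ p^-1)%R.
have L1 : (1 < L)%R.
  have pV0 : (0 < p^-1)%R by rewrite invr_gt0.
  have lt_eta : (1 < 1 + eta)%R by rewrite ltrDl.
  have := @gt0_ltr_powR R p^-1%R pV0 1%R (1 + eta)%R.
  by rewrite !nnegrE powR1; apply => //; rewrite addr_ge0// ltW.
have Lpos : (0 < L)%R by apply: lt_trans L1.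
have Lp : (L `^ (N%:R + s) * L ^+ N * L ^+ N * L ^+ N = 1 + eta)%R.
  rewrite -!powR_mulrn ?(ltW Lpos)// -!powRD; try by rewrite (gt_eqF Lpos) implybT.
  rewrite -/p /L -powRrM mulVf ?gt_eqF// powRr1// addr_ge0// ltW//.
have [f [fL fO]] := inward_deformation oOmega bOmega lipO L1.
pose E' := f @^-1` E.
have mE' : measurable E' by exact: (measurable_preimage_near_isometry (ltW L1) fL).
have cE' : closure E' `<=` Omega.
  move=> x cx; apply: contrapT => /fO ofx.
  have cf := near_isometry_continuous (ltW L1) fL.
  have [y [Ey]] : E' `&` f @^-1` ((~` Omega)°) !=set0.
    apply: cx; apply: cf; apply: open_nbhs_nbhs; split => //.
    exact: open_interior.
  by move=> /interior_subset; apply; exact: EO.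
have vol := volume_near_isometry (ltW L1) fL mE.
have per := perimeter_near_isometry (ltW L1) fL s0 mE.
have LN0 : (0 < L ^+ N)%R by rewrite exprn_gt0.
have E'0 : 0 < lebesgue_rV E'.
  rewrite lt0e measure_ge0 andbT; apply/eqP => E'0.
  by move: vol; rewrite -/E' E'0 mule0 leNgt E0.
have E'fin : lebesgue_rV E' < +oo.
  apply: lebesgue_bounded_fin => //; apply: sub_bounded_set bOmega.
  by apply: subset_trans cE'; exact: subset_closure.
apply: le_trans (lambda11_le_compactly_contained s mE' cE' E'0) _.
have [m' m'0 E'm] : exists2 m', (0 < m')%R & lebesgue_rV E' = m'%:E.
  by move: E'0 E'fin; case: (lebesgue_rV E') => // m'; rewrite lte_fin; exists m'.
move: vol per; rewrite -/E' E'm Em EP -!EFinM lee_fin => vol per.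
rewrite /cheeger_ratio E'm EFin_inv// lee_pdivrMr//.
apply: le_trans per _; rewrite -EFinD -EFinM lee_fin.
set C := (L `^ (N%:R + s) * L ^+ N * L ^+ N)%R in Lp *.
have C0 : (0 <= C)%R by rewrite !mulr_ge0 ?powR_ge0 ?(ltW LN0).
apply: (@le_trans _ _ ((1 + eta) * (P / m) * m')%R).
  have Pm : (P <= P / m * (L ^+ N * m'))%R.
    by rewrite -[leLHS](divfK (lt0r_neq0 m0)) ler_wpM2l.
  apply: le_trans (ler_wpM2l C0 Pm) _.
  by rewrite -Lp; set q := (P / m)%R; rewrite le_eqVlt; apply/orP; left; apply/eqP; ring.
rewrite ler_wpM2r ?(ltW m'0)// mulrDl mul1r lerD2l.
rewrite /eta mulrAC ler_pdivrMr ?ltr_wpDl// ler_wpM2l ?(ltW e0)//.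
by rewrite lerDl.
Qed.

Lemma lambda11_ge_cheeger s : cheeger_constant s Omega <= lambda11 s Omega.
Proof.
apply/ereal_infP => _ [u [[Lu _] u1 u0] <-].
have [->|Wu] := eqVneq (Ws1_seminorm s u) +oo; first by rewrite leey.
have cu : calW s Omega u by split => //; rewrite ltey.
have := @cheeger_le_quotient _ _ s Omega oOmega bOmega u cu.
rewrite u1 inve1 mule1; apply => ae0.
have : L1norm Omega u = 0.
  rewrite /L1norm.
  have mO : measurable Omega by exact: measurable_open_rV.
  transitivity (\int[lebesgue_rV]_(x in Omega) `|(u x)%:E|); first by [].
  apply/ae_eq_integral_abs => //.
    have [mu _ _] := Lu; apply/measurable_EFinP; exact: measurable_funTS.
  by apply: filterS ae0 => x -> _.
  by rewrite u1 => -[] /eqP; rewrite oner_eq0.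
Qed.

End smooth_competitors.

Theorem theorem5p8 (R : realType) (N : nat) (hN : (0 < N)%N)
    (s : R) (hs0 : (0 < s)%R) (hs1 : (s < 1)%R)
    (Omega : set 'rV[R]_N) (oOmega : open Omega) (bOmega : bounded_set Omega) :
  [/\ forall u : 'rV[R]_N -> R, calW s Omega u ->
        ~ {ae lebesgue_rV, forall x, u x = 0%R} ->
        cheeger_constant s Omega <= Ws1_seminorm s u / L1norm Omega u,
      forall u : 'rV[R]_N -> R, calW s Omega u ->
        ~ {ae lebesgue_rV, forall x, u x = 0%R} ->
        Ws1_seminorm s u / L1norm Omega u = cheeger_constant s Omega ->
        {ae lebesgue_measure, forall t : R, (0 < t)%R ->
          0 < lebesgue_rV (superlevel Omega u t) ->
          cheeger_set s Omega (superlevel Omega u t)} &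
      lipschitz_boundary Omega ->
        lambda11 s Omega = cheeger_constant s Omega].
Proof.
split => [u Wu u0|u Wu u0 Eq|lipO].
- exact: cheeger_le_quotient.
- exact: cheeger_set_superlevel Eq.
apply/eqP; rewrite eq_le lambda11_ge_cheeger// andbT.
by apply/ereal_infP => _ [E aE <-]; exact: lambda11_le_ratio.
Qed.
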